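(* Let $\mu$ be a nonnegative Borel measure on $\mathbb B$. Then $\mu$ is a Carleson measure for the Hardy space $H^2(\mathbb B)$ if and only if there is a constant $C>0$ such that for every $q\in\mathbb B$ the symmetric box $S(q)$ satisfies $$\mu(S(q))\le C\,(1-|q|).$$
   Context: $\mathbb H$ is the skew-field of quaternions, $\mathbb B=\{q\in\mathbb H:|q|<1\}$, $\mathbb S=\{q\in\mathbb H:q^2=-1\}$. $H^2(\mathbb B)$ is the space of functions $f(q)=\sum_{n\ge0}q^na_n$ on $\mathbb B$, $a_n\in\mathbb H$, with $\|f\|^2_{H^2(\mathbb B)}=\sum|a_n|^2<\infty$. A nonnegative Borel measure $\mu$ on $\mathbb B$ is a Carleson measure for $H^2(\mathbb B)$ if there is a constant $c(\mu)$ with $\int_{\mathbb B}|f(q)|^2d\mu(q)\le c(\mu)\|f\|^2_{H^2(\mathbb B)}$ for all $f\in H^2(\mathbb B)$. For $q=re^{J\theta}\in\mathbb B$, with $r\ge0$, $\theta\in\mathbb R$, $J\in\mathbb S$ (where $e^{J\theta}=\cos\theta+J\sin\theta$), the symmetric box is $$S(q)=\{\varrho e^{I\alpha}\in\mathbb B:\ \varrho\ge 0,\ |\alpha-\theta|\le 1-r,\ 0<1-\varrho\le 2(1-r),\ I\in\mathbb S\}.$$ It does not depend on the choice of $J$. (For $q=0$, any $\theta$ may be used.) *)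

(* Defs.v *)
From HB Require Import structures.
From mathcomp Require Import all_boot all_order all_algebra.
From mathcomp Require Import ring lra.
From mathcomp Require Import all_classical all_reals all_analysis.
Set Implicit Arguments.
Unset Strict Implicit.
Unset Printing Implicit Defensive.
Import Order.TTheory GRing.Theory Num.Theory.
Import numFieldNormedType.Exports.
Local Open Scope classical_set_scope.
Local Open Scope ring_scope.

(* Quat a b c d stands for a + b i + c j + d k, where i^2 = j^2 = k^2 = ijk = -1. *)
Record quat (R : Type) := Quat { q1 : R ; qi : R ; qj : R ; qk : R }.

Section Choice.
Variable R : choiceType.
Definition quat_tuple (q : quat R) := (q1 q, qi q, qj q, qk q).
Definition tuple_quat (t : R * R * R * R) :=
  let: (a, b, c, d) := t in Quat a b c d.
Lemma quat_tupleK : cancel quat_tuple tuple_quat. Proof. by case. Qed.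
HB.instance Definition _ := Choice.copy (quat R) (can_type quat_tupleK).
End Choice.

Section Quaternions.
Variable R : realType.
Implicit Types x y z : quat R.

Lemma quat_ext x y :
  q1 x = q1 y -> qi x = qi y -> qj x = qj y -> qk x = qk y -> x = y.
Proof. by case: x => ? ? ? ?; case: y => ? ? ? ? /= -> -> -> ->. Qed.

Definition addq x y :=
  Quat (q1 x + q1 y) (qi x + qi y) (qj x + qj y) (qk x + qk y).
Definition oppq x := Quat (- q1 x) (- qi x) (- qj x) (- qk x).

Lemma addqA : associative addq.
Proof. by move=> x y z; apply: quat_ext; rewrite /= addrA. Qed.
Lemma addqC : commutative addq.
Proof. by move=> x y; apply: quat_ext; rewrite /= addrC. Qed.
Lemma add0q : left_id (Quat 0 0 0 0) addq.
Proof. by move=> x; apply: quat_ext; rewrite /= add0r. Qed.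
Lemma addNq : left_inverse (Quat 0 0 0 0) oppq addq.
Proof. by move=> x; apply: quat_ext; rewrite /= addNr. Qed.

HB.instance Definition _ :=
  GRing.isZmodule.Build (quat R) addqA addqC add0q addNq.

Definition mulq x y :=
  Quat (q1 x * q1 y - qi x * qi y - qj x * qj y - qk x * qk y)
       (q1 x * qi y + qi x * q1 y + qj x * qk y - qk x * qj y)
       (q1 x * qj y - qi x * qk y + qj x * q1 y + qk x * qi y)
       (q1 x * qk y + qi x * qj y - qj x * qi y + qk x * q1 y).

Lemma mulqA : associative mulq.
Proof. by move=> x y z; apply: quat_ext => /=; ring. Qed.
Lemma mul1q : left_id (Quat 1 0 0 0) mulq.
Proof. by move=> x; apply: quat_ext => /=; ring. Qed.
Lemma mulq1 : right_id (Quat 1 0 0 0) mulq.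
Proof. by move=> x; apply: quat_ext => /=; ring. Qed.
Lemma mulqDl : left_distributive mulq +%R.
Proof. by move=> x y z; apply: quat_ext => /=; ring. Qed.
Lemma mulqDr : right_distributive mulq +%R.
Proof. by move=> x y z; apply: quat_ext => /=; ring. Qed.
Lemma oneq_neq0 : Quat 1 0 0 0 != 0 :> quat R.
Proof. by apply/eqP => -[] /eqP; rewrite oner_eq0. Qed.

HB.instance Definition _ := GRing.Zmodule_isNzRing.Build (quat R)
  mulqA mul1q mulq1 mulqDl mulqDr oneq_neq0.

Definition scaleq (a : R) x := Quat (a * q1 x) (a * qi x) (a * qj x) (a * qk x).

Lemma scaleqA a b x : scaleq a (scaleq b x) = scaleq (a * b) x.
Proof. by apply: quat_ext; rewrite /= mulrA. Qed.
Lemma scale1q : left_id 1 scaleq.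
Proof. by move=> x; apply: quat_ext; rewrite /= mul1r. Qed.
Lemma scaleqDr : right_distributive scaleq +%R.
Proof. by move=> a x y; apply: quat_ext; rewrite /= mulrDr. Qed.
Lemma scaleqDl x : {morph scaleq^~ x : a b / a + b}.
Proof. by move=> a b; apply: quat_ext; rewrite /= mulrDl. Qed.

HB.instance Definition _ := GRing.Zmodule_isLmodule.Build R (quat R)
  scaleqA scale1q scaleqDr scaleqDl.

Lemma scaleqAl (a : R) x y : a *: (x * y) = (a *: x) * y.
Proof. by apply: quat_ext => /=; ring. Qed.
HB.instance Definition _ := GRing.Lmodule_isLalgebra.Build R (quat R) scaleqAl.

Lemma scaleqAr (a : R) x y : a *: (x * y) = x * (a *: y).
Proof. by apply: quat_ext => /=; ring. Qed.
HB.instance Definition _ := GRing.Lalgebra_isAlgebra.Build R (quat R) scaleqAr.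

Definition sqnormq x := q1 x ^+ 2 + qi x ^+ 2 + qj x ^+ 2 + qk x ^+ 2.
Definition normq x := Num.sqrt (sqnormq x).

Lemma sqnormq_ge0 x : 0 <= sqnormq x.
Proof. by rewrite !addr_ge0 // sqr_ge0. Qed.

Lemma normqD x y : normq (x + y) <= normq x + normq y.
Proof.
have nx : 0 <= normq x := sqrtr_ge0 _.
have ny : 0 <= normq y := sqrtr_ge0 _.
rewrite -ler_sqr ?nnegrE ?sqrtr_ge0 ?addr_ge0 // sqrrD !sqr_sqrtr ?sqnormq_ge0 //.
pose s := q1 x * q1 y + qi x * qi y + qj x * qj y + qk x * qk y.
suff hs : s <= normq x * normq y by rewrite /sqnormq /= /s in hs *; lra.
apply: le_trans (ler_norm _) _; rewrite -sqrtr_sqr -sqrtrM ?sqnormq_ge0 //.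
rewrite ler_wsqrtr // /s /sqnormq -subr_ge0.
set e := (X in 0 <= X).
have -> : e = (q1 x * qi y - qi x * q1 y) ^+ 2 + (q1 x * qj y - qj x * q1 y) ^+ 2
            + (q1 x * qk y - qk x * q1 y) ^+ 2 + (qi x * qj y - qj x * qi y) ^+ 2
            + (qi x * qk y - qk x * qi y) ^+ 2 + (qj x * qk y - qk x * qj y) ^+ 2.
  by rewrite /e; ring.
by rewrite !addr_ge0 // sqr_ge0.
Qed.

Lemma normqZ (a : R) x : normq (a *: x) = `|a| * normq x.
Proof.
by rewrite -sqrtr_sqr -sqrtrM ?sqr_ge0 //; congr Num.sqrt; rewrite /sqnormq /=; ring.
Qed.

Lemma normq_eq0 x : normq x = 0 -> x = 0.
Proof.
move=> /eqP; rewrite sqrtr_eq0 => le0.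
have /eqP : sqnormq x = 0 by apply/eqP; rewrite eq_le le0 sqnormq_ge0.
rewrite /sqnormq !paddr_eq0 ?addr_ge0 ?sqr_ge0 // !sqrf_eq0.
by move=> /andP[/andP[/andP[/eqP ? /eqP ?] /eqP ?] /eqP ?]; apply: quat_ext.
Qed.

(* The topology of quat R is the one of the Euclidean norm. *)
HB.instance Definition _ :=
  @Lmodule_isNormed.Build R (quat R) normq normqD normqZ normq_eq0.

(* quat R carries the Borel sigma-algebra, generated by its open sets. *)
HB.instance Definition _ := @isMeasurable.Build
  (sigma_display (@open (quat R))) (quat R) <<s @open (quat R) >>
  (@sigma_algebra0 _ setT (@open (quat R))) (@sigma_algebraC _ (@open (quat R)))
  (@sigma_algebra_bigcup _ setT (@open (quat R))).

End Quaternions.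

Section CarlesonMeasures.
Variable R : realType.

Definition unit_ball : set (quat R) := [set q | `|q| < 1].

Definition imag_units : set (quat R) := [set I | I ^+ 2 = -1].

Definition expq (I : quat R) (t : R) : quat R := (cos t)%:A + sin t *: I.

Definition hardy_sqnorm (a : nat -> quat R) : \bar R :=
  (\sum_(0 <= n <oo) (`|a n| ^+ 2)%:E)%E.

(* f restricts to the element of H^2 of the unit ball with coefficients a; the
   values of f outside the unit ball are irrelevant. *)
Definition hardy_expansion (f : quat R -> quat R) (a : nat -> quat R) : Prop :=
  (hardy_sqnorm a < +oo)%E /\
  forall q, unit_ball q -> series (fun n => q ^+ n * a n) @ \oo --> f q.

(* Borel measures on the unit ball are represented by Borel measures on quat R,
   of which only the restriction to the unit ball is used. *)
Definition carleson_measure (mu : {measure set (quat R) -> \bar R}) : Prop :=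
  exists c : R, forall f a, hardy_expansion f a ->
    (\int[mu]_(q in unit_ball) (`|f q| ^+ 2)%:E <= c%:E * hardy_sqnorm a)%E.

(* The box S(q) for q = r e^{J theta}; it does not involve J. *)
Definition symmetric_box (r theta : R) : set (quat R) :=
  [set p | unit_ball p /\ exists rho alpha I,
    [/\ p = rho *: expq I alpha, 0 <= rho, imag_units I,
        `|alpha - theta| <= 1 - r & 0 < 1 - rho <= 2 * (1 - r)]].

End CarlesonMeasures.

(* Main.v *)
(* Write q = rho e^{I al} with al in [0, pi] and I an imaginary unit. Then
   q^n = rho^n (cos (n al) + I sin (n al)), so the values of f at q are governed
   by real trigonometric sums in (rho, al), one for each real component of the
   coefficients, and the problem becomes one on the upper half disc.

   If mu is Carleson, testing on the sum of the Szego kernels at r e^{i theta} and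
   at its conjugate gives the box condition: the real part of each of the two is
   nonnegative, and that of one of them is at least 1 / (10 (1 - r)) on the box.

   Conversely, cut the half disc into Whitney cells [n, i], at distance about
   2^-n from the sphere and with angle in [4 i 2^-n, 4 (i + 1) 2^-n), and replace
   |f|^2 on each cell by its value at a nearly optimal point. By duality (TT* ),
   the embedding for these finitely many weighted points follows from the bound of
   the quadratic form with kernel Re (1 / (1 - z \bar w)) >= 0, which is at most
   1/2 + 512 * 2^n / (1 + d)^2 when z lies in the cell [n, i] and d is the distance
   from i to the ancestor of the cell of w in generation n. The quadratic form is
   then controlled by a dyadic Carleson embedding theorem for the smeared masses
   [\sum_l m_(n,l) / (1 + |l - i|)^2], proved by a Bellman function induction. *)
Require Import Defs.
From HB Require Import structures.
From mathcomp Require Import all_boot all_order all_algebra.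
From mathcomp Require Import ring lra zify.
From mathcomp Require Import all_classical all_reals all_analysis.
From mathcomp Require Import measurable_realfun.
Set Implicit Arguments.
Unset Strict Implicit.
Unset Printing Implicit Defensive.
Import Order.TTheory GRing.Theory Num.Theory.
Import numFieldNormedType.Exports.
Local Open Scope classical_set_scope.
Local Open Scope ring_scope.

(** * Dyadic Carleson embedding *)

Section DyadicTree.
Variable R : realFieldType.
Implicit Types (f g m x : nat -> nat -> R) (d n i k : nat).

(** The children of node [(n, i)] are [(n.+1, i.*2)] and [(n.+1, i.*2.+1)], so [i * 2 ^ k + c] runs
    over its descendants [k] generations below. The cut after [d] generations keeps every sum
    finite. *)
Definition tree_sum d n i f : R :=
  \sum_(k < d) \sum_(c < 2 ^ k) f (n + k)%N (i * 2 ^ k + c)%N.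

Lemma tree_sum0 n i f : tree_sum 0 n i f = 0.
Proof. by rewrite /tree_sum big_ord0. Qed.

Lemma tree_sumS d n i f :
  tree_sum d.+1 n i f =
  f n i + tree_sum d n.+1 i.*2 f + tree_sum d n.+1 i.*2.+1 f.
Proof.
rewrite /tree_sum big_ord_recl /= big_ord_recl big_ord0 addr0 addn0 muln1 addn0.
rewrite -addrA; congr (_ + _); rewrite -big_split; apply: eq_bigr => k _ /=.
rewrite /bump /= add1n expnS mul2n -addnn big_split_ord /=.
by congr (_ + _); apply: eq_bigr => c _; congr f; nia.
Qed.

Lemma tree_sum_ge0 d n i f : (forall n i, 0 <= f n i) -> 0 <= tree_sum d n i f.
Proof. by move=> f0; do 2![apply: sumr_ge0 => ? _]. Qed.

(* A vanishing denominator comes with a vanishing numerator, so that the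
   convention [x / 0 = 0] is harmless. *)
Lemma titu (a b p q : R) : 0 <= p -> 0 <= q -> (p = 0 -> a = 0) ->
  (q = 0 -> b = 0) -> (a + b) ^+ 2 / (p + q) <= a ^+ 2 / p + b ^+ 2 / q.
Proof.
move=> p0 q0 pa qb; have [pz|pn] := eqVneq p 0.
  by rewrite pz pa // !add0r expr0n mul0r add0r.
have [qz|qn] := eqVneq q 0.
  by rewrite qz qb // !addr0 expr0n mul0r addr0.
have pp : 0 < p by rewrite lt_def pn.
have qq : 0 < q by rewrite lt_def qn.
rewrite -subr_ge0.
have -> : a ^+ 2 / p + b ^+ 2 / q - (a + b) ^+ 2 / (p + q)
   = (a * q - b * p) ^+ 2 / (p * q * (p + q)).
  by field; rewrite pn qn; rewrite lt0r_neq0 ?addr_gt0.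
by rewrite divr_ge0 ?sqr_ge0 // !mulr_ge0 // addr_ge0.
Qed.

(** Provides the side conditions of [titu]: a vanishing denominator has a vanishing numerator. *)
Lemma tree_sum_eq0 d n i m x : (forall n i, 0 <= m n i) ->
  tree_sum d n i m = 0 -> tree_sum d n i (fun n i => m n i * x n i) = 0.
Proof.
move=> m0; elim: d n i => [|d IH] n i; first by rewrite !tree_sum0.
rewrite !tree_sumS => /eqP.
rewrite !paddr_eq0 ?addr_ge0 ?tree_sum_ge0 // => /andP[/andP[/eqP z /eqP z1] /eqP z2].
by rewrite !IH // z mul0r !addr0.
Qed.

(** Enlarging the denominator from [D] to [D + v] loses [G ^+ 2 * v / (D * (D + v))], where both
    factors below are at most [2 * K / 2 ^+ n]. *)
Lemma bellman_gap (K G D v : R) n : 0 < K -> 0 <= D -> 0 <= v ->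
  D + v <= 2 * (K / 2 ^+ n) -> (D = 0 -> G = 0) ->
  v * 4 ^+ n * G ^+ 2 <= 4 * K ^+ 2 * (G ^+ 2 / D - G ^+ 2 / (D + v)).
Proof.
move=> K0 D0 v0 Dv DG; have [Dz|Dn] := eqVneq D 0.
  by rewrite DG // expr0n /= !(mul0r, mulr0) subr0 mulr0.
have Dp : 0 < D by rewrite lt_def Dn.
have t0 : 2 ^+ n != 0 :> R by rewrite expf_neq0 ?pnatr_eq0.
have four : 4 ^+ n = 2 ^+ n * 2 ^+ n :> R by rewrite -exprMn -natrM.
have Dvn : D + v != 0 by rewrite lt0r_neq0 //; lra.
have DDv : D * (D + v) <= 4 * K ^+ 2 / 4 ^+ n.
  have -> : 4 * K ^+ 2 / 4 ^+ n = (2 * (K / 2 ^+ n)) * (2 * (K / 2 ^+ n)).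
    by rewrite four; field.
  apply: ler_pM => //; lra.
have -> : G ^+ 2 / D - G ^+ 2 / (D + v) = G ^+ 2 * v / (D * (D + v)).
  by field; rewrite Dn Dvn.
rewrite [leRHS]mulrA ler_pdivlMr; last by rewrite mulr_gt0 //; lra.
have -> : 4 * K ^+ 2 * (G ^+ 2 * v) = v * 4 ^+ n * G ^+ 2 * (4 * K ^+ 2 / 4 ^+ n).
  by rewrite four; field.
apply: ler_wpM2l => //; rewrite mulr_ge0 ?sqr_ge0 //.
by rewrite mulr_ge0 ?exprn_ge0.
Qed.

(* The right-hand side is the Bellman function of the induction: [titu] makes it
   superadditive over the children, and [bellman_gap] pays for the node itself. *)
Lemma dyadic_carleson_bellman (K : R) m v x D :
  (forall n i, 0 <= m n i) -> (forall n i, 0 <= v n i) -> 0 < K ->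
  (forall d n i, tree_sum d n i m <= K / 2 ^+ n) ->
  (forall d n i, tree_sum d n i v <= K / 2 ^+ n) ->
  forall d n i, (n + d)%N = D ->
  tree_sum d n i (fun n i => v n i * 4 ^+ n *
      tree_sum (D - n) n i (fun n i => m n i * x n i) ^+ 2) <=
  4 * K ^+ 2 * (tree_sum d n i (fun n i => m n i * x n i ^+ 2) -
    tree_sum d n i (fun n i => m n i * x n i) ^+ 2 /
    (tree_sum d n i m + tree_sum d n i v)).
Proof.
move=> m0 v0 K0 mK vK; elim => [|d IH] n i nd.
  by rewrite !tree_sum0 expr0n mul0r subr0 mulr0.
have nd1 : (n.+1 + d)%N = D by lia.
(* The inner sum stops at the absolute generation [D], as the outer one does, so at the node itself
   it is [g + G1 + G2] in the notation below. *)
have nd2 : (D - n)%N = d.+1 by lia.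
have mKs := mK d.+1 n i; have vKs := vK d.+1 n i.
have z1 := @tree_sum_eq0 d n.+1 i.*2 m x m0.
have z2 := @tree_sum_eq0 d n.+1 i.*2.+1 m x m0.
rewrite [X in X <= _]tree_sumS nd2; move: (IH n.+1 i.*2 nd1) (IH n.+1 i.*2.+1 nd1).
rewrite !(tree_sumS d n i) in mKs vKs *.
have M1 := tree_sum_ge0 d n.+1 i.*2 m0; have M2 := tree_sum_ge0 d n.+1 i.*2.+1 m0.
have A1 := tree_sum_ge0 d n.+1 i.*2 v0; have A2 := tree_sum_ge0 d n.+1 i.*2.+1 v0.
move: (m0 n i) (v0 n i) z1 z2 M1 M2 A1 A2 mKs vKs.
(* Forgets the structure of the subtree sums: from here on the argument concerns real numbers
   only. *)
have gen F : exists s t, tree_sum d n.+1 i.*2 F = s /\ tree_sum d n.+1 i.*2.+1 F = t.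
  by do 2!eexists.
have [M1 [M2 [-> ->]]] := gen m; have [A1 [A2 [-> ->]]] := gen v.
have [X1 [X2 [-> ->]]] := gen (fun n i => m n i * x n i ^+ 2).
have [G1 [G2 [-> ->]]] := gen (fun n i => m n i * x n i).
have [S1 [S2 [-> ->]]] := gen (fun n i => v n i * 4 ^+ n *
      tree_sum (D - n) n i (fun n i => m n i * x n i) ^+ 2).
move=> m00 v00 z1 z2 M10 M20 A10 A20 mKs vKs IH1 IH2.
set X := m n i * x n i ^+ 2.
set g := m n i * x n i.
set M := m n i + M1 + M2; set A := v n i + A1 + A2.
have hg := @bellman_gap K (g + G1 + G2) (m n i + M1 + A1 + (M2 + A2)) (v n i) n K0.
have t1 := @titu (g + G1) G2 (m n i + (M1 + A1)) (M2 + A2).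
have t2 := @titu g G1 (m n i) (M1 + A1).
have hx : g ^+ 2 / m n i <= X.
  rewrite /g /X; have [->|mn] := eqVneq (m n i) 0; first by rewrite !mul0r expr0n mul0r.
  by rewrite exprMn expr2 mulrAC -mulrA [m n i * _ / _]mulrC mulKf // mulrC.
have gz : m n i = 0 -> g = 0 by rewrite /g => ->; rewrite mul0r.
have {}hg : v n i * 4 ^+ n * (g + G1 + G2) ^+ 2 <=
  4 * K ^+ 2 * ((g + G1 + G2) ^+ 2 / (m n i + (M1 + A1) + (M2 + A2)) -
  (g + G1 + G2) ^+ 2 / (M + A)).
  have -> : M + A = m n i + M1 + A1 + (M2 + A2) + v n i by rewrite /M /A; ring.
  rewrite [m n i + (_ + _)]addrA; apply: hg => //; [lra|lra|].
  by move=> z; rewrite gz ?z1 ?z2 ?add0r ?addr0 //; lra.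
have {}t1 : (g + G1 + G2) ^+ 2 / (m n i + (M1 + A1) + (M2 + A2)) <=
  (g + G1) ^+ 2 / (m n i + (M1 + A1)) + G2 ^+ 2 / (M2 + A2).
  by apply: t1; [lra|lra| |] => z; rewrite ?gz ?z1 ?z2 ?add0r ?addr0 //; lra.
have {}t2 : (g + G1) ^+ 2 / (m n i + (M1 + A1)) <= g ^+ 2 / m n i + G1 ^+ 2 / (M1 + A1).
  by apply: t2; [lra|lra| |] => z; rewrite ?gz ?z1 ?z2 ?add0r ?addr0 //; lra.
have K2 : 0 <= 4 * K ^+ 2 by rewrite mulr_ge0 // sqr_ge0.
(* The quotients in the induction hypotheses cancel against those of [t1] and [t2], and [hx] absorbs
   the remaining [g ^+ 2 / m n i] into [X]. *)
apply: (le_trans (lerD (lerD hg IH1) IH2)).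
rewrite -!mulrDr ler_wpM2l //.
move: hx t1 t2; rewrite -/g -/X.
by lra.
Qed.
End DyadicTree.

(** * Smeared masses *)

Section Smear.
Variable R : realFieldType.
Implicit Types (f g m x : nat -> nat -> R) (d n i k : nat).

Definition absdiff (i j : nat) : nat := ((i - j) + (j - i))%N.

(** The decay of the kernel between cells of one generation at distance [e], shifted by one to stay
    finite at [e = 0]. *)
Definition weight (e : nat) : R := (e.+1%:R ^+ 2)^-1.

Lemma weight_gt0 e : 0 < weight e.
Proof. by rewrite invr_gt0 exprn_gt0. Qed.

Lemma weight_ge0 e : 0 <= weight e. Proof. exact/ltW/weight_gt0. Qed.

Lemma absdiffC i j : absdiff i j = absdiff j i.
Proof. by rewrite /absdiff addnC. Qed.

Lemma sum_block (a b : nat) (F : nat -> R) :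
  \sum_(l < a * b) F l = \sum_(i < a) \sum_(c < b) F (i * b + c)%N.
Proof.
elim: a => [|a IH]; first by rewrite mul0n !big_ord0.
by rewrite mulSnr big_split_ord big_ord_recr /= IH.
Qed.

Lemma inv_sqr_le_telescope (y : nat) :
  (y.+2%:R ^+ 2)^-1 <= y.+1%:R^-1 - y.+2%:R^-1 :> R.
Proof.
have p : 0 < y.+1%:R :> R by rewrite ltr0n.
rewrite -[y.+2]addn1 natrD -subr_ge0.
move: (y.+1%:R : R) p => z p.
have -> : z^-1 - (z + 1)^-1 - ((z + 1) ^+ 2)^-1 = (z * (z + 1) ^+ 2)^-1.
  by field; rewrite ?lt0r_neq0 //; lra.
by rewrite invr_ge0 mulr_ge0 ?sqr_ge0 // ltW.
Qed.

Lemma sum_weight_init (l L : nat) : \sum_(j < L) weight (absdiff l j) <= 4.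
Proof.
(* The induction on [L] carries the telescoped remainders on either side of [l]; the term at [l]
   itself adds 1 to a sum at most 1, below [4 - 1]. *)
suff [h1 h2] : ((L <= l)%N ->
     \sum_(j < L) weight (absdiff l j) <= (l - L).+1%:R^-1 :> R) /\
   ((l < L)%N -> \sum_(j < L) weight (absdiff l j) <= 4 - (L - l)%:R^-1 :> R).
  have [Ll|lL] := leqP L l.
    apply: le_trans (h1 Ll) _.
    have : (l - L).+1%:R^-1 <= 1 :> R by rewrite invf_le1 // ler1n.
    by move/le_trans; apply; rewrite (ler_nat _ 1 4).
  by apply: le_trans (h2 lL) _; rewrite gerBl invr_ge0.
elim: L => [|L [h1 h2]]; first by rewrite big_ord0; split=> // _; rewrite invr_ge0.
rewrite big_ord_recr /=; set S := \sum_(_ < _) _ in h1 h2 *; split=> hL.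
  have e : (l - L = (l - L.+1).+1)%N by lia.
  have ew : absdiff l L = (l - L.+1).+1 by rewrite /absdiff; lia.
  have := h1 (ltnW hL); rewrite /weight ew e.
  have := inv_sqr_le_telescope (l - L.+1).
  by move=> h h'; apply: le_trans (lerD h' h) _; rewrite addrC subrK.
have [lL|Ll] := ltnP l L.
  have e : (L.+1 - l = (L - l.+1).+2)%N by lia.
  have e' : (L - l = (L - l.+1).+1)%N by lia.
  have ew : absdiff l L = (L - l.+1).+1 by rewrite /absdiff; lia.
  have := h2 lL; rewrite /weight ew e e'.
  have := inv_sqr_le_telescope (L - l.+1).
  by move=> h h'; apply: le_trans (lerD h' h) _; rewrite addrA subrK.
have eL : L = l by lia.
have e : (l.+1 - l = 1)%N by lia.
have := h1 Ll; rewrite /weight /absdiff eL subnn addn0 e expr1n !invr1.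
by lra.
Qed.

Lemma sum_weight_interval (l s L : nat) :
  \sum_(c < L) weight (absdiff l (s + c)) <= 4.
Proof.
apply: le_trans (sum_weight_init l (s + L)).
by rewrite big_split_ord /= lerDr sumr_ge0 // => c _; exact: weight_ge0.
Qed.

(** Points of two blocks of length [B] at block distance [e >= 2] are more than [(e - 1) * B] apart,
    and [3 * (e - 1) >= e + 1]. *)
Lemma absdiff_block (a b c i B : nat) : (b < B)%N -> (c < B)%N -> (1 < absdiff a i)%N ->
  (B * (absdiff a i).+1 <= 3 * (absdiff (a * B + b) (i * B + c)).+1)%N.
Proof.
rewrite /absdiff => bB cB; have [ai|ia] := leqP a i.
  have -> : (i = a + (i - a))%N by lia.
  move: (i - a)%N => e; rewrite mulnDl. nia.
have -> : (a = i + (a - i))%N by lia.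
move: (a - i)%N => e; rewrite mulnDl. nia.
Qed.

(** For distant blocks each of the [2 ^ k] terms is at most [9 / 4 ^ k] times the weight of the
    block distance. For equal or adjacent blocks that weight is at least 1/4, and the total bound 4
    suffices. *)
Lemma sum_weight_block (l i k : nat) :
  \sum_(c < 2 ^ k) weight (absdiff l (i * 2 ^ k + c)) <=
  16 * weight (absdiff (l %/ 2 ^ k) i).
Proof.
have [e1|e2] := leqP (absdiff (l %/ 2 ^ k) i) 1.
  apply: le_trans (sum_weight_interval _ _ _) _.
  suff : 4^-1 <= weight (absdiff (l %/ 2 ^ k) i) by lra.
  have -> : 4^-1 = (2 ^+ 2)^-1 :> R by rewrite -natrX.
  rewrite lef_pV2 ?posrE ?exprn_gt0 ?ltr0n //.
  by rewrite ler_pXn2r ?nnegrE ?ler0n // (ler_nat _ _ 2).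
have B0 : (0 < 2 ^ k)%N by rewrite expn_gt0.
have bB : (l %% 2 ^ k < 2 ^ k)%N by rewrite ltn_mod.
set e := absdiff _ _ in e2 *.
have wE (c : 'I_(2 ^ k)) : weight (absdiff l (i * 2 ^ k + c)) <=
    9 * weight e * (2 ^ k)%:R^-1 * (2 ^ k)%:R^-1.
  have := absdiff_block bB (ltn_ord c) e2; rewrite -divn_eq -/e.
  rewrite /weight; set y := (absdiff _ _).+1 => hy.
  have {}hy : (2 ^ k)%:R * e.+1%:R <= 3 * y%:R :> R by rewrite -!natrM ler_nat.
  have y0 : 0 < y%:R :> R by rewrite ltr0n.
  have e0 : 0 < e.+1%:R :> R by rewrite ltr0n.
  have b0 : 0 < (2 ^ k)%:R :> R by rewrite ltr0n.
  move: (y%:R : R) (e.+1%:R : R) ((2 ^ k)%:R : R) hy y0 e0 b0 => u v B hy y0 e0 b0.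
  have -> : 9 * (v ^+ 2)^-1 * B^-1 * B^-1 = ((B * v / 3) ^+ 2)^-1.
    by field; rewrite !lt0r_neq0.
  rewrite lef_pV2 ?posrE ?exprn_gt0 ?divr_gt0 ?mulr_gt0 //.
  have p : 0 <= B * v / 3 by apply/ltW/divr_gt0; [exact: mulr_gt0|rewrite ltr0n].
  by rewrite ler_pXn2r ?nnegrE ?(ltW y0) // ler_pdivrMr // [u * _]mulrC.
apply: (le_trans (ler_sum _ (fun c _ => wE c))).
rewrite sumr_const card_ord -[_ *+ _]mulr_natr divfK ?pnatr_eq0 -?lt0n //.
have : (2 ^ k)%:R^-1 <= 1 :> R by rewrite invf_le1 ?ltr0n // ler1n.
by move/(ler_wpM2l (weight_ge0 e)); have := weight_ge0 e; lra.
Qed.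

(** Spreads each mass over its generation, so that the off-diagonal weights of the quadratic form
    are collected into one mass per node. *)
Definition smear m n i : R := \sum_(l < 2 ^ n) weight (absdiff l i) * m n l.

Lemma smear_ge0 m n i : (forall n i, 0 <= m n i) -> 0 <= smear m n i.
Proof. by move=> m0; apply: sumr_ge0 => l _; rewrite mulr_ge0 // weight_ge0. Qed.

(** Smearing preserves the packing condition: grouped by their ancestor [j] in generation [n], the
    masses enter with factor 16 times the weight of the distance from [j] to [i], and these weights
    sum to at most 4. *)
Lemma tree_sum_smear (K : R) m d n i : (forall n i, 0 <= m n i) ->
  (forall d n i, (i < 2 ^ n)%N -> tree_sum d n i m <= K / 2 ^+ n) ->
  tree_sum d n i (smear m) <= 64 * K / 2 ^+ n.
Proof.
move=> m0 mK.
have bd (k : nat) : \sum_(c < 2 ^ k) smear m (n + k) (i * 2 ^ k + c) <=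
    \sum_(j < 2 ^ n) 16 * weight (absdiff j i) *
      \sum_(c < 2 ^ k) m (n + k)%N (j * 2 ^ k + c)%N.
  rewrite /smear exchange_big /=.
  under eq_bigr => l _ do rewrite -mulr_suml.
  rewrite expnD (sum_block _ _ (fun l => (\sum_(c < 2 ^ k)
     weight (absdiff l (i * 2 ^ k + c))) * m (n + k)%N l)).
  apply: ler_sum => j _; rewrite mulr_sumr; apply: ler_sum => c _.
  rewrite ler_wpM2r //.
  by apply: (le_trans (sum_weight_block _ _ _)); rewrite divnMDl ?expn_gt0 // divn_small // addn0.
rewrite /tree_sum; apply: (le_trans (ler_sum _ (fun (k : 'I_d) _ => bd k))).
rewrite exchange_big /=; under eq_bigr => j _ do rewrite -mulr_sumr.
have K0 : 0 <= K / 2 ^+ n.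
  by apply: le_trans (mK 0%N n 0%N _); rewrite ?tree_sum0 ?expn_gt0.
apply: (@le_trans _ _ (\sum_(j < 2 ^ n) weight (absdiff i j) * (16 * (K / 2 ^+ n)))).
  apply: ler_sum => j _; rewrite absdiffC [16 * _]mulrC -mulrA.
  by rewrite ler_wpM2l ?weight_ge0 // ler_wpM2l //; exact: mK.
rewrite -mulr_suml -[64 * K / _]mulrA.
have := ler_wpM2r K0 (sum_weight_init i (2 ^ n)).
by lra.
Qed.

End Smear.

(** * The quadratic form of the kernel *)

Section Forms.
Variable R : realFieldType.
Implicit Types (f g m x : nat -> nat -> R) (d n i k : nat).

Lemma tree_sum_root D f :
  tree_sum D 0 0 f = \sum_(n < D) \sum_(i < 2 ^ n) f n i.
Proof.
by apply: eq_bigr => n _; apply: eq_bigr => i _; rewrite add0n mul0n add0n.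
Qed.

Lemma tree_sum_descendants D n (F : nat -> nat -> R) : (n <= D)%N ->
  \sum_(k < D | (n <= k)%N) \sum_(i < 2 ^ k) F k i =
  \sum_(j < 2 ^ n) tree_sum (D - n) n j F.
Proof.
move=> nD; rewrite /tree_sum exchange_big /=.
transitivity (\sum_(k < D - n) \sum_(i < 2 ^ (n + k)) F (n + k)%N i).
  move: nD => /subnKC; move: (D - n)%N => d <-; rewrite big_split_ord /= big_pred0 => [|k]; last first.
    by rewrite leqNgt ltn_ord.
  by rewrite add0r; apply: eq_bigl => k; rewrite leq_addr.
apply: eq_bigr => k _; rewrite expnD.
by rewrite (sum_block _ _ (F (n + k)%N)).
Qed.

Lemma two_mul_le (a b : R) : a * b <= (a ^+ 2 + b ^+ 2) / 2.
Proof. by have := sqr_ge0 (a - b); lra. Qed.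

(** A Schur test: [two_mul_le] applied to [x n i] and [2 ^+ n * G n j] separates the variables.
    Summing the weights bounds the first part by [2 * X]; the second is [S / 2], which the Bellman
    induction controls with the packing constant [64 * K], valid for both [m] and its smear. *)
Lemma dyadic_form_le (K : R) D m x : 0 < K ->
  (forall n i, 0 <= m n i) ->
  (forall d n i, tree_sum d n i m <= K / 2 ^+ n) ->
  \sum_(n < D) \sum_(i < 2 ^ n) m n i * x n i * 2 ^+ n *
    (\sum_(j < 2 ^ n) weight R (absdiff i j) *
       tree_sum (D - n) n j (fun n i => m n i * x n i)) <=
  (2 + 8192 * K ^+ 2) * \sum_(n < D) \sum_(i < 2 ^ n) m n i * x n i ^+ 2.
Proof.
move=> K0 m0 mK; set g := fun n i => m n i * x n i.
pose G n j := tree_sum (D - n) n j g.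
have K64 : 0 < 64 * K by rewrite mulr_gt0.
have mK64 d n i : tree_sum d n i m <= 64 * K / 2 ^+ n.
  apply: le_trans (mK d n i) _; rewrite ler_wpM2r ?invr_ge0 ?exprn_ge0 //; lra.
have sK d n i : tree_sum d n i (smear m) <= 64 * K / 2 ^+ n.
  by apply: tree_sum_smear.
have := dyadic_carleson_bellman x m0 (fun n i => smear_ge0 n i m0) K64 mK64 sK 0%N (add0n D).
rewrite !tree_sum_root.
pose X := \sum_(n < D) \sum_(i < 2 ^ n) m n i * x n i ^+ 2.
pose S := \sum_(n < D) \sum_(i < 2 ^ n) smear m n i * 4 ^+ n * G n i ^+ 2.
rewrite -/X -/S => SX.
have {}SX : S <= 16384 * K ^+ 2 * X.
  apply: le_trans SX _.
  have -> : 16384 * K ^+ 2 * X = 4 * (64 * K) ^+ 2 * X by ring.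
  apply: ler_wpM2l; first by rewrite mulr_ge0 // sqr_ge0.
  rewrite gerBl divr_ge0 ?sqr_ge0 //.
  apply: addr_ge0; do 2![apply: sumr_ge0 => ? _] => //; exact: smear_ge0.
suff : \sum_(n < D) \sum_(i < 2 ^ n) g n i * 2 ^+ n *
    (\sum_(j < 2 ^ n) weight R (absdiff i j) * G n j) <= 2 * X + S / 2.
  by move/le_trans; apply; lra.
rewrite /X /S mulr_sumr mulr_suml -big_split; apply: ler_sum => n _ /=.
apply: (@le_trans _ _ (\sum_(i < 2 ^ n) \sum_(j < 2 ^ n)
   (m n i * x n i ^+ 2 / 2 * weight R (absdiff i j) +
    weight R (absdiff i j) * m n i * (4 ^+ n * G n j ^+ 2 / 2)))).
  apply: ler_sum => i _; rewrite mulr_sumr; apply: ler_sum => j _.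
  have := two_mul_le (x n i) (2 ^+ n * G n j).
  have -> : 4 ^+ n = (2 ^+ n) ^+ 2 :> R by rewrite expr2 -exprMn -natrM.
  have := m0 n i; have := weight_ge0 R (absdiff i j).
  rewrite /g; move: (weight _ _) (m n i) (G n j) (2 ^+ n) => w mm gg t w0 mm0 h.
  by have := ler_wpM2l (mulr_ge0 w0 mm0) h; lra.
under [leLHS]eq_bigr => i _ do rewrite big_split /= -mulr_sumr.
rewrite big_split /=; apply: lerD.
  rewrite mulr_sumr; apply: ler_sum => i _.
  have p : 0 <= m n i * x n i ^+ 2 / 2 by rewrite divr_ge0 // mulr_ge0 // sqr_ge0.
  have := ler_wpM2l p (sum_weight_init R i (2 ^ n)); lra.
rewrite exchange_big mulr_suml /=; apply: ler_sum => j _.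
by rewrite -mulr_suml /smear !mulrA.
Qed.

End Forms.

Section KernelForm.
Variable R : realFieldType.
Implicit Types (f g m x : nat -> nat -> R) (d n i k : nat).

(** Packs generation and position into one finite index, over which the kernel becomes a square
    matrix. *)
Definition cell (D : nat) : finType := {n : 'I_D & 'I_(2 ^ n)}.
Definition cell_gen D (p : cell D) : nat := tag p.
Definition cell_pos D (p : cell D) : nat := tagged p.

Lemma sum_cell D f :
  \sum_(p : cell D) f (cell_gen p) (cell_pos p) =
  \sum_(n < D) \sum_(i < 2 ^ n) f n i.
Proof. symmetry.
exact: (@sig_big_dep _ _ +%R _ (fun n : 'I_D => 'I_(2 ^ n)) xpredT
  (fun _ => xpredT) (fun (n : 'I_D) (i : 'I_(2 ^ n)) => f n i)). Qed.

(** [i' %/ 2 ^ (n' - n)] is the ancestor of [i'] in generation [n]. The value 0 for [n' < n] means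
    that a pair is weighed from its coarser cell. *)
Definition ancestor_weight n i n' i' : R :=
  if (n <= n')%N then 2 ^+ n * weight R (absdiff i (i' %/ 2 ^ (n' - n))) else 0.

Lemma sum_ancestor_weight D n i g : (n < D)%N ->
  \sum_(q : cell D) g (cell_gen q) (cell_pos q) *
     ancestor_weight n i (cell_gen q) (cell_pos q) =
  2 ^+ n * \sum_(j < 2 ^ n) weight R (absdiff i j) * tree_sum (D - n) n j g.
Proof.
move=> nD; rewrite (sum_cell D (fun k l => g k l * ancestor_weight n i k l)).
rewrite (bigID (fun k : 'I_D => n <= k)%N) /= [X in _ + X]big1 ?addr0; last first.
  move=> k nk; rewrite big1 // => l _.
  by rewrite /ancestor_weight (negbTE nk) mulr0.
rewrite (tree_sum_descendants (fun k l => g k l * ancestor_weight n i k l) (ltnW nD)).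
rewrite mulr_sumr; apply: eq_bigr => j _.
rewrite mulrCA /tree_sum mulr_sumr mulr_sumr; apply: eq_bigr => k _.
rewrite !mulr_sumr; apply: eq_bigr => c _.
rewrite /ancestor_weight leq_addr addnC addnK divnMDl ?expn_gt0 // divn_small //.
by rewrite addn0; ring.
Qed.

(** The constant part of the kernel bound costs the total mass, at most [K], by Cauchy-Schwarz. The
    decaying part, taken in both orders of the pair, is twice the form of [dyadic_form_le]. *)
Lemma kernel_form_le (K : R) D m x (mx : cell D -> R)
    (P : cell D -> cell D -> R) : 0 < K ->
  (forall n i, 0 <= m n i) -> (forall n i, 0 <= x n i) ->
  (forall d n i, tree_sum d n i m <= K / 2 ^+ n) ->
  (forall p q, P p q = P q p) ->
  (forall p q, (cell_gen p <= cell_gen q)%N ->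
     P p q <= 2^-1 + 512 *
       ancestor_weight (cell_gen p) (cell_pos p) (cell_gen q) (cell_pos q)) ->
  (forall p, mx p = m (cell_gen p) (cell_pos p) * x (cell_gen p) (cell_pos p)) ->
  \sum_p \sum_q mx p * mx q * P p q <=
  (K + 1024 * (2 + 8192 * K ^+ 2)) *
  \sum_(p : cell D) m (cell_gen p) (cell_pos p) * x (cell_gen p) (cell_pos p) ^+ 2.
Proof.
move=> K0 m0 x0 mK Psym Ple mxE.
pose X := \sum_(p : cell D) m (cell_gen p) (cell_pos p) * x (cell_gen p) (cell_pos p) ^+ 2.
rewrite -/X.
have mx0 p : 0 <= mx p by rewrite mxE mulr_ge0.
pose H (p q : cell D) :=
  ancestor_weight (cell_gen p) (cell_pos p) (cell_gen q) (cell_pos q).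
have H0 p q : 0 <= H p q.
  by rewrite /H /ancestor_weight; case: ifP => // _; rewrite mulr_ge0 ?exprn_ge0 ?weight_ge0.
have PH p q : P p q <= 2^-1 + 512 * H p q + 512 * H q p.
  have := H0 p q; have := H0 q p.
  case/orP: (leq_total (cell_gen p) (cell_gen q)) => pq.
    by have := Ple _ _ pq; rewrite -/(H p q); lra.
  by have := Ple _ _ pq; rewrite -/(H q p) Psym; lra.
have form : \sum_p \sum_q mx p * mx q * H p q <= (2 + 8192 * K ^+ 2) * X.
  rewrite /X (sum_cell D (fun n i => m n i * x n i ^+ 2)).
  apply: le_trans (dyadic_form_le D x K0 m0 mK).
  rewrite -(sum_cell D (fun n i => m n i * x n i * 2 ^+ n *
    (\sum_(j < 2 ^ n) weight R (absdiff i j) *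
       tree_sum (D - n) n j (fun n i => m n i * x n i)))).
  apply: ler_sum => p _; under eq_bigr => q _ do rewrite -mulrA.
  rewrite -mulr_sumr -mxE -mulrA; apply: ler_wpM2l => //.
  under eq_bigr => q _ do rewrite mxE.
  by rewrite /H (@sum_ancestor_weight D _ _ (fun n i => m n i * x n i)) ?ltn_ord.
have mass : \sum_(p : cell D) m (cell_gen p) (cell_pos p) <= K.
  by have := mK D 0%N 0%N; rewrite expr0 divr1 tree_sum_root -sum_cell.
have X0 : 0 <= X by apply: sumr_ge0 => p _; rewrite mulr_ge0 ?sqr_ge0.
have square : \sum_p \sum_q mx p * mx q <= K * X.
  apply: (@le_trans _ _ (\sum_(p : cell D) \sum_(q : cell D)
     (m (cell_gen p) (cell_pos p) * x (cell_gen p) (cell_pos p) ^+ 2 / 2 *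
        m (cell_gen q) (cell_pos q) +
      m (cell_gen p) (cell_pos p) *
        (m (cell_gen q) (cell_pos q) * x (cell_gen q) (cell_pos q) ^+ 2 / 2)))).
    apply: ler_sum => p _; apply: ler_sum => q _; rewrite !mxE.
    have := m0 (cell_gen p) (cell_pos p); have := m0 (cell_gen q) (cell_pos q).
    move: (m _ _) (m _ _) (x _ _) (x _ _) => a b y z a0 b0.
    by have := ler_wpM2l (mulr_ge0 a0 b0) (two_mul_le y z); lra.
  under eq_bigr => p _ do rewrite big_split /= -!mulr_sumr.
  rewrite big_split /= -!mulr_suml -/X.
  by have := ler_wpM2r X0 mass; lra.
apply: (@le_trans _ _ (\sum_p \sum_q (2^-1 * (mx p * mx q) +
   512 * (mx p * mx q * H p q) + 512 * (mx q * mx p * H q p)))).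
  apply: ler_sum => p _; apply: ler_sum => q _.
  by have := ler_wpM2l (mulr_ge0 (mx0 p) (mx0 q)) (PH p q); lra.
have -> : \sum_p \sum_q (2^-1 * (mx p * mx q) +
     512 * (mx p * mx q * H p q) + 512 * (mx q * mx p * H q p)) =
   2^-1 * (\sum_p \sum_q mx p * mx q) + 512 * (\sum_p \sum_q mx p * mx q * H p q) +
   512 * (\sum_p \sum_q mx q * mx p * H q p).
  rewrite !mulr_sumr -!big_split; apply: eq_bigr => p _ /=.
  by rewrite !mulr_sumr -!big_split.
rewrite [X in _ + _ * X]exchange_big /=.
by have := mulr_ge0 (ltW K0) X0; lra.
Qed.

End KernelForm.

(** * Duality and the Szego kernel *)

Section TTstar.
Variable R : realFieldType.

(** With [b] the adjoint image of [c], the left-hand side is the pairing of [a] and [b], hence at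
    most [C / 2] times the energy of [a] plus [1 / (2 * C)] times that of [b]. The hypothesis bounds
    the latter term by half the left-hand side, which is absorbed. *)
Lemma dual_square_bound (J : finType) (m : J -> R) (A : nat -> J -> R) (C : R) N
    (a : nat -> R) (c := fun j => \sum_(n < N) a n * A n j) :
  0 < C ->
  \sum_(n < N) (\sum_j m j * c j * A n j) ^+ 2 <= C * \sum_j m j * c j ^+ 2 ->
  \sum_j m j * (\sum_(n < N) a n * A n j) ^+ 2 <= C * \sum_(n < N) a n ^+ 2.
Proof.
move=> C0 hX.
pose b n := \sum_j m j * c j * A n j.
have XE : \sum_j m j * c j ^+ 2 = \sum_(n < N) a n * b n.
  under [RHS]eq_bigr => n _ do rewrite /b mulr_sumr.
  rewrite exchange_big /=; apply: eq_bigr => j _.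
  rewrite expr2 {2}/c mulr_sumr mulr_sumr; apply: eq_bigr => n _.
  by ring.
set X := \sum_j _ in XE hX *.
set E := \sum_(n < N) a n ^+ 2.
suff : X <= C * E / 2 + C^-1 * (\sum_(n < N) b n ^+ 2) / 2.
  have Ci : 0 <= C^-1 by rewrite invr_ge0 ltW.
  have := ler_wpM2l Ci hX; rewrite mulKf ?lt0r_neq0 // -/b.
  by lra.
rewrite XE /E !mulr_sumr !mulr_suml -big_split; apply: ler_sum => n _ /=.
have := sqr_ge0 (C * a n - b n); rewrite -(pmulr_rge0 _ (_ : 0 < C^-1)) ?invr_gt0 //.
have -> : C^-1 * (C * a n - b n) ^+ 2 = C * a n ^+ 2 + C^-1 * b n ^+ 2 - 2 * (a n * b n).
  by field; rewrite lt0r_neq0.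
by lra.
Qed.
End TTstar.

(** * Trigonometric series and bounds for the real part of the Szego kernel *)

Section Trig.
Variable R : realType.
Implicit Types (t x al be de : R).

Lemma cvg_sumr (V : normedModType R) (I : Type) (r : seq I) (f : I -> nat -> V) (l : I -> V) :
  (forall i, f i @ \oo --> l i) ->
  (fun n => \sum_(i <- r) f i n) @ \oo --> \sum_(i <- r) l i.
Proof.
move=> fl; elim: r => [|i r IH].
  by under eq_fun do rewrite big_nil; rewrite big_nil; exact: cvg_cst.
under eq_fun do rewrite big_cons; rewrite big_cons.
exact: cvgD.
Qed.

Definition pden t de : R := 1 - 2 * t * cos de + t ^+ 2.

Lemma pdenE t de : pden t de = (1 - t) ^+ 2 + 2 * t * (1 - cos de).
Proof. by rewrite /pden; ring. Qed.

Lemma pden_gt0 t de : 0 <= t < 1 -> 0 < pden t de.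
Proof.
move=> /andP[t0 t1]; rewrite pdenE ltr_wpDr //.
  by rewrite mulr_ge0 ?mulr_ge0 // subr_ge0 cos_le1.
by rewrite exprn_gt0 // subr_gt0.
Qed.

(** The real part of a finite geometric sum with ratio [t e^(i de)]. The phase [be] lets one formula
    serve cosines and sines. *)
Lemma geometric_cos_partial t de be N :
  pden t de * (\sum_(n < N) t ^+ n * cos (n%:R * de + be)) =
  cos be - t * cos (be - de) -
  (t ^+ N * cos (N%:R * de + be) - t ^+ N.+1 * cos (N%:R * de + be - de)).
Proof.
elim: N => [|N IH]; first by rewrite big_ord0 !mul0r add0r expr0 expr1; ring.
rewrite big_ord_recr /= mulrDr IH.
have -> : N.+1%:R * de + be = N%:R * de + be + de by rewrite -[in LHS]natr1; ring.
set u := N%:R * de + be; rewrite addrK (cosB u de) (cosD u de) /pden !exprS.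
by ring.
Qed.

Lemma geometric_cos_cvg t de be : 0 <= t < 1 ->
  (fun N => \sum_(n < N) t ^+ n * cos (n%:R * de + be)) @ \oo -->
  (cos be - t * cos (be - de)) / pden t de.
Proof.
move=> t01; have p0 := pden_gt0 de t01.
have tN : `|t| < 1 by rewrite ger0_norm; case/andP: t01.
have cvg0 (u : nat -> R) (v : nat -> R) : (forall n, `|v n| <= 1) ->
   (fun n => t ^+ n * v n) @ \oo --> (0 : R).
  move=> hv; apply/norm_cvg0P; apply: (@squeeze_cvgr _ _ _ _ (cst 0) (fun n => `|t| ^+ n)).
  - near=> n; rewrite normr_ge0 normrM normrX /=.
    by rewrite ler_piMr // exprn_ge0.
  - exact: cvg_cst.
  - by apply: cvg_expr; rewrite normr_id.
have -> : (fun N => \sum_(n < N) t ^+ n * cos (n%:R * de + be)) =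
  (fun N => (cos be - t * cos (be - de) -
  (t ^+ N * cos (N%:R * de + be) - t * (t ^+ N * cos (N%:R * de + be - de)))) / pden t de).
  apply/funext => N; rewrite mulrA -exprS -geometric_cos_partial mulrC mulKf //.
  exact: lt0r_neq0.
have -> : (cos be - t * cos (be - de)) / pden t de =
    (cos be - t * cos (be - de) - (0 - t * 0)) / pden t de by rewrite mulr0 !subr0.
apply: cvgMl; apply: cvgB; first exact: cvg_cst.
apply: cvgB; first by apply: cvg0 => // n; exact: cos_max.
by apply: cvgMr; apply: cvg0 => // n; exact: cos_max.
Unshelve. all: by end_near. Qed.

(* The real part of [1 / (1 - t e^(i de))]; [pden] is [|1 - t e^(i de)|^2]. *)
Definition pker t de : R := (1 - t * cos de) / pden t de.

Lemma pker_ge0 t de : 0 <= t < 1 -> 0 <= pker t de.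
Proof.
move=> t01; rewrite divr_ge0 ?(ltW (pden_gt0 _ t01)) //.
case/andP: t01 => t0 t1; have := ler_wpM2l t0 (cos_le1 de); lra.
Qed.

Lemma pker_cvg t de : 0 <= t < 1 ->
  (fun N => \sum_(n < N) t ^+ n * cos (n%:R * de)) @ \oo --> pker t de.
Proof.
move=> t01; have := @geometric_cos_cvg t de 0 t01.
rewrite cos0 sub0r cosN; under eq_fun => N do under eq_bigr => n _ do rewrite addr0.
by [].
Qed.

(** Integrates an inequality; three successive uses lead from [cos <= 1] to the Taylor bounds
    below. *)
Lemma ge0_of_derive (f df : R^o -> R^o) : (forall x, is_derive x 1 f (df x)) ->
  (forall x, 0 <= x -> 0 <= df x) -> f 0 = 0 -> forall x, 0 <= x -> 0 <= f x.
Proof.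
move=> fdf df0 f0 x x0.
have [c c0x] := MVT_segment x0 (fun y _ => fdf y)
  (derivable_within_continuous (fun y _ => @ex_derive _ _ _ _ _ _ _ (fdf y))).
rewrite f0 !subr0 => ->; rewrite mulr_ge0 // df0 //.
by move: c0x; rewrite in_itv /= => /andP[].
Qed.

Lemma sin_le_id x : 0 <= x -> sin x <= x.
Proof.
move=> x0; rewrite -subr_ge0.
have d (y : R^o) : is_derive y 1 (fun x : R^o => x - sin x : R^o) (1 - cos y).
  by apply: is_derive_eq.
apply: (ge0_of_derive d) x0 => [y _|]; first by rewrite subr_ge0 cos_le1.
by rewrite sin0 subrr.
Qed.

Lemma cos_ge_quadratic x : 0 <= x -> 1 - x ^+ 2 / 2 <= cos x.
Proof.
move=> x0; rewrite -subr_ge0.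
have d (y : R^o) :
    is_derive y 1 (fun x : R^o => cos x - (1 - x ^+ 2 / 2) : R^o) (y - sin y).
  by apply: is_derive_eq; rewrite /GRing.scale /=; field.
apply: (ge0_of_derive d) x0 => [y y0|]; first by rewrite subr_ge0 sin_le_id.
by rewrite cos0 expr0n /= mul0r subr0 subrr.
Qed.

Lemma sin_ge_cubic x : 0 <= x -> x - x ^+ 3 / 6 <= sin x.
Proof.
move=> x0; rewrite -subr_ge0.
have d (y : R^o) : is_derive y 1 (fun x : R^o => sin x - (x - x ^+ 3 / 6) : R^o)
    (cos y - (1 - y ^+ 2 / 2)).
  by apply: is_derive_eq; rewrite /GRing.scale /=; field.
apply: (ge0_of_derive d) x0 => [y y0|]; first by rewrite subr_ge0 cos_ge_quadratic.
by rewrite sin0 expr0n /= mul0r !subr0.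
Qed.

(** [1 - cos x] is twice the square of [sin (x / 2)], and [sin y >= y - y ^+ 3 / 6 >= y / 3] for
    [0 <= y <= 2]. The range 4 covers all differences of angles of cells. *)
Lemma one_sub_cos_ge x : `|x| <= 4 -> x ^+ 2 / 18 <= 1 - cos x.
Proof.
move=> x4.
wlog x0 : x x4 / 0 <= x.
  move=> h; have [|x0] := leP 0 x; first exact: h.
  by rewrite -sqrrN -cosN; apply: h; rewrite ?normrN // oppr_ge0 ltW.
have {}x4 : x <= 4 by rewrite ger0_norm in x4.
pose y := x / 2; have -> : x = y *+ 2 by rewrite /y -[_ *+ 2]mulr_natr divfK.
have y0 : 0 <= y by rewrite divr_ge0.
have y2 : y <= 2 by rewrite /y; lra.
rewrite cos_mulr2n cos2sin2.
have s : y / 3 <= sin y.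
  apply: le_trans (sin_ge_cubic y0).
  have : y ^+ 2 <= 2 ^+ 2 by rewrite ler_pXn2r ?nnegrE.
  move=> /(ler_wpM2l y0); rewrite -exprS => h; lra.
have s2 : (y / 3) ^+ 2 <= sin y ^+ 2.
  by rewrite ler_pXn2r ?nnegrE ?divr_ge0 // (le_trans _ s) // divr_ge0.
rewrite -[_ *+ 2]mulr_natr -[_ *+ 2]mulr_natr; lra.
Qed.

(** By the cosine subtraction formula the squares expand into partial sums of the kernel series. As
    sums of squares these are nondecreasing in [N], hence below their limit. *)
Lemma pker_square_sum (J : finType) (rho al y : J -> R) N :
  (forall j, 0 <= rho j < 1) ->
  \sum_(n < N) ((\sum_j y j * (rho j ^+ n * cos (n%:R * al j))) ^+ 2 +
               (\sum_j y j * (rho j ^+ n * sin (n%:R * al j))) ^+ 2) <=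
  \sum_j \sum_k y j * y k * pker (rho j * rho k) (al j - al k).
Proof.
move=> rho01.
pose U N := \sum_(n < N) ((\sum_j y j * (rho j ^+ n * cos (n%:R * al j))) ^+ 2 +
               (\sum_j y j * (rho j ^+ n * sin (n%:R * al j))) ^+ 2).
have UE M : U M = \sum_j \sum_k y j * y k *
    \sum_(n < M) (rho j * rho k) ^+ n * cos (n%:R * (al j - al k)).
  under [RHS]eq_bigr => j _ do under eq_bigr => k _ do rewrite mulr_sumr.
  under [RHS]eq_bigr => j _ do rewrite exchange_big /=.
  rewrite exchange_big /=; apply: eq_bigr => n _.
  rewrite !expr2 !mulr_suml -big_split; apply: eq_bigr => j _ /=.
  rewrite !mulr_sumr -big_split; apply: eq_bigr => k _ /=.
  by rewrite mulrBr cosB exprMn; ring.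
have Uc : U @ \oo --> \sum_j \sum_k y j * y k * pker (rho j * rho k) (al j - al k).
  rewrite (_ : U = fun M => \sum_j \sum_k y j * y k *
    \sum_(n < M) (rho j * rho k) ^+ n * cos (n%:R * (al j - al k))); last exact/funext.
  apply: cvg_sumr => j; apply: cvg_sumr => k; apply: cvgMr; apply: pker_cvg.
  have /andP[j0 j1] := rho01 j; have /andP[k0 k1] := rho01 k.
  by rewrite mulr_ge0 //= mulr_ilt1.
rewrite -(cvg_lim (@Rhausdorff R) Uc); apply: nondecreasing_cvgn_le; last exact: cvgP Uc.
apply/nondecreasing_seqP => n; rewrite /U big_ord_recr /= lerDl.
by rewrite addr_ge0 ?sqr_ge0.
Qed.

(** Here [h] is the scale of the coarser cell and [e] the distance of positions. The kernel is 1/2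
    plus half the Poisson kernel, whose halved numerator is at most [2 * h] and whose denominator is
    at least [((e + 1) * h) ^+ 2 / 256]. *)
Lemma pker_le (h e de1 de2 al1 al2 : R) : 0 < h -> 0 <= e ->
  h / 2 < de1 <= h -> 0 < de2 <= h -> h <= 1 -> `|al1 - al2| <= 4 ->
  (e - 1) * h <= `|al1 - al2| ->
  pker ((1 - de1) * (1 - de2)) (al1 - al2) <=
  2^-1 + 512 * (h^-1 * ((e + 1) ^+ 2)^-1).
Proof.
move=> h0 e0 /andP[d1 d1'] /andP[d2 d2'] h1 th4 eh.
set t := _ * _; set th := al1 - al2 in th4 eh *.
have t0 : 0 <= t by rewrite mulr_ge0 //; lra.
have t1 : 1 - t <= 2 * h.
  have -> : 1 - t = de1 + de2 - de1 * de2 by rewrite /t; ring.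
  have : 0 <= de1 * de2 by rewrite mulr_ge0 //; lra.
  by lra.
have t1' : h / 2 <= 1 - t.
  have -> : 1 - t = de1 + de2 * (1 - de1) by rewrite /t; ring.
  have : 0 <= de2 * (1 - de1) by rewrite mulr_ge0 //; lra.
  by lra.
have p0 : 0 < pden t th by apply: pden_gt0; rewrite t0; lra.
have pE := pdenE t th.
have -> : pker t th = 2^-1 + (1 - t ^+ 2) / 2 / pden t th.
  rewrite /pker; have -> : 1 - t * cos th = pden t th / 2 + (1 - t ^+ 2) / 2.
    by rewrite /pden; field.
  by field; rewrite lt0r_neq0.
rewrite lerD2l.
have pl : (e + 1) ^+ 2 * h ^+ 2 / 256 <= pden t th.
  have s0 : (h / 2) ^+ 2 <= (1 - t) ^+ 2.
    by rewrite ler_pXn2r ?nnegrE //; lra.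
  have th2 : th ^+ 2 <= 16.
    have -> : 16 = 4 ^+ 2 :> R by rewrite -natrX.
    by rewrite -real_normK ?num_real // ler_pXn2r ?nnegrE.
  have c1 := one_sub_cos_ge th4.
  have p1 : (h / 2) ^+ 2 / 2 + th ^+ 2 / 128 <= pden t th.
    have th0 := sqr_ge0 th.
    have cth : 0 <= 1 - cos th by rewrite subr_ge0 cos_le1.
    (* For [t <= 1/2], [(1 - t) ^+ 2 >= 1/4] dominates since [th ^+ 2 <= 16]; otherwise [2 * t >= 1]
       and [one_sub_cos_ge] gives the angular term. *)
    have [tl|tg] := leP t 2^-1.
      have : 2^-1 ^+ 2 <= (1 - t) ^+ 2 by rewrite ler_pXn2r ?nnegrE //; lra.
      by have := mulr_ge0 t0 cth; lra.
    have t12 : 0 <= t - 2^-1 by lra.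
    by have := mulr_ge0 t12 cth; lra.
  apply: le_trans p1.
  have th0 := normr_ge0 th.
  have a0 : 0 <= (e + 1) * h by rewrite mulr_ge0 //; lra.
  have le1 : (e + 1) * h <= 2 * h + `|th| by lra.
  have : ((e + 1) * h) ^+ 2 <= (2 * h + `|th|) ^+ 2.
    by rewrite ler_pXn2r ?nnegrE //; lra.
  have := sqr_ge0 h; have := sqr_ge0 (2 * h - `|th|); rewrite -(real_normK (num_real th)).
  by lra.
rewrite ler_pdivrMr //.
have tt : (1 - t ^+ 2) / 2 <= 2 * h.
  have -> : (1 - t ^+ 2) / 2 = (1 - t) - (1 - t) ^+ 2 / 2 by field.
  by have := sqr_ge0 (1 - t); lra.
apply: (le_trans tt).
have q0 : 0 <= 512 * (h^-1 * ((e + 1) ^+ 2)^-1).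
  apply: mulr_ge0; first by rewrite ler0n.
  by apply: mulr_ge0; rewrite invr_ge0; [exact: ltW|exact: sqr_ge0].
apply: le_trans (ler_wpM2l q0 pl).
rewrite le_eqVlt; apply/orP; left; apply/eqP.
have e1 : (e + 1) ^+ 2 != 0 by rewrite expf_neq0 // lt0r_neq0 //; lra.
have -> : 512 = 2 * 256 :> R by rewrite -natrM.
have : 256 != 0 :> R by rewrite pnatr_eq0.
move: ((e + 1) ^+ 2) (256 : R) e1 => E c E0 c0.
by field; rewrite c0 E0 lt0r_neq0.
Qed.

End Trig.

(** * The discrete embedding theorem *)

Section Discrete.
Variable R : realType.
Implicit Types (rho al K : R).

(** With angular width [4 * 2^-n], the [2 ^ n] cells of generation [n] cover [[0, 4]], which
    contains [[0, pi]] and has dyadic subdivision points. *)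
Definition in_cell (n i : nat) (rho al : R) : Prop :=
  2^-1 ^+ n / 2 < 1 - rho <= 2^-1 ^+ n /\
  4 * i%:R * 2^-1 ^+ n <= al <= 4 * i.+1%:R * 2^-1 ^+ n.

(** By nesting, [al'] lies in the angular interval of its ancestor in generation [n]; intervals
    whose indices differ by [e >= 1] are at least [e - 1] interval lengths apart. *)
Lemma in_cell_ancestor n i n' i' rho al rho' al' : (n <= n')%N ->
  in_cell n i rho al -> in_cell n' i' rho' al' ->
  ((absdiff i (i' %/ 2 ^ (n' - n)))%:R - 1) * 2^-1 ^+ n <= `|al - al'|.
Proof.
move=> nn [_ /andP[a1 a2]] [_ /andP[b1 b2]].
set k := (n' - n)%N; set j := (i' %/ 2 ^ k)%N.
have h0 : 0 <= 2^-1 ^+ n :> R by rewrite exprn_ge0.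
have hE : 2^-1 ^+ n = 2^-1 ^+ n' * (2 ^ k)%:R :> R.
  rewrite -(subnKC nn) -/k exprD natrX -mulrA -exprMn mulVf ?pnatr_eq0 //.
  by rewrite expr1n mulr1.
have h'0 : 0 <= 2^-1 ^+ n' :> R by rewrite exprn_ge0.
have B0 : (0 < 2 ^ k)%N by rewrite expn_gt0.
have j1 : (j * 2 ^ k)%:R <= i'%:R :> R by rewrite ler_nat leq_divM.
have j2 : i'.+1%:R <= (j.+1 * 2 ^ k)%:R :> R by rewrite ler_nat ltn_ceil.
have b1' : 4 * j%:R * 2^-1 ^+ n <= al'.
  apply: le_trans b1; have := ler_wpM2r h'0 j1; rewrite natrM hE; lra.
have b2' : al' <= 4 * j.+1%:R * 2^-1 ^+ n.
  apply: (le_trans b2); have := ler_wpM2r h'0 j2; rewrite natrM hE; lra.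
move: b1' b2' a1 a2; rewrite -[i.+1%:R]natr1 -[j.+1%:R]natr1; set h := 2^-1 ^+ n in h0 *.
have sep (x y u v : R) : u <= 4 * (x + 1) * h -> 4 * y * h <= v ->
    (y - x - 1) * h <= `|v - u|.
  move=> hu hv; have [s|s] := leP 0 (y - x - 1).
    by have := mulr_ge0 s h0; have := ler_norm (v - u); lra.
  apply: le_trans (normr_ge0 _); rewrite mulr_le0_ge0 //; exact: ltW.

rewrite /absdiff; case: (leqP i j) => ij.
  have -> : (i - j + (j - i) = j - i)%N by lia.
  rewrite natrB //.
  by rewrite distrC => b1' _ _ a2'; apply: sep.
have -> : (i - j + (j - i) = i - j)%N by lia.
by rewrite natrB ?(ltnW ij) // => _ b2' a1' _; apply: sep.
Qed.

Definition embedding_const K : R := K + 1024 * (2 + 8192 * K ^+ 2).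

Lemma embedding_const_gt0 K : 0 < K -> 0 < embedding_const K.
Proof.
move=> K0; have := sqr_ge0 K; rewrite /embedding_const => K2.
by lra.
Qed.

Section Embedding.
Variables (K : R) (D : nat) (m rho al : nat -> nat -> R).
Hypotheses (K0 : 0 < K) (m0 : forall n i, 0 <= m n i)
  (mK : forall d n i, tree_sum d n i m <= K / 2 ^+ n)
  (cellP : forall n i, in_cell n i (rho n i) (al n i)).

Let rh (p : cell D) := rho (cell_gen p) (cell_pos p).
Let ang (p : cell D) := al (cell_gen p) (cell_pos p).
Let mass (p : cell D) := m (cell_gen p) (cell_pos p).

Let rh01 p : 0 <= rh p < 1.
Proof.
have [/andP[h1 h2] _] := cellP (cell_gen p) (cell_pos p); rewrite -/(rh p) in h1 h2.
have h0 : 0 < 2^-1 ^+ cell_gen p :> R by rewrite exprn_gt0.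
have h01 : 2^-1 ^+ cell_gen p <= 1 :> R by rewrite exprn_ile1 // invf_le1 ?ler1n.
by apply/andP; split; lra.
Qed.

Let ang04 p : 0 <= ang p <= 4.
Proof.
have [_ /andP[h1 h2]] := cellP (cell_gen p) (cell_pos p); rewrite -/(ang p) in h1 h2.
rewrite (le_trans _ h1) ?mulr_ge0 ?exprn_ge0 //= (le_trans h2) //.
have : (cell_pos p).+1%:R <= (2 ^ cell_gen p)%:R :> R by rewrite ler_nat ltn_ord.
have h0 : 0 <= 2^-1 ^+ cell_gen p :> R by rewrite exprn_ge0.
move=> /(ler_wpM2r h0); rewrite natrX -exprMn mulfV ?pnatr_eq0 // expr1n.
by lra.
Qed.

(** Since the kernel is nonnegative, passing to [|y|] only increases the form, and the entrywise
    bound of [kernel_form_le] becomes applicable. *)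
Let form_le (y : nat -> nat -> R) (my := fun p => mass p * y (cell_gen p) (cell_pos p)) :
  \sum_p \sum_q my p * my q * pker (rh p * rh q) (ang p - ang q) <=
  embedding_const K * \sum_p mass p * y (cell_gen p) (cell_pos p) ^+ 2.
Proof.
pose x n i := `|y n i|.
have -> : \sum_p mass p * y (cell_gen p) (cell_pos p) ^+ 2 =
    \sum_p mass p * x (cell_gen p) (cell_pos p) ^+ 2.
  by apply: eq_bigr => p _; rewrite /x real_normK ?num_real.
apply: (@le_trans _ _ (\sum_p \sum_q `|my p| * `|my q| *
    pker (rh p * rh q) (ang p - ang q))).
  apply: ler_sum => p _; apply: ler_sum => q _; rewrite -normrM.
  apply: ler_wpM2r; last exact: ler_norm.
  apply: pker_ge0; have /andP[p0 p1] := rh01 p; have /andP[q0 q1] := rh01 q.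
  by rewrite mulr_ge0 //= mulr_ilt1.
apply: (@kernel_form_le _ K D m x (fun p => `|my p|)) => //.
- by move=> n i; exact: normr_ge0.
- by move=> p q; rewrite /pker /pden [rh p * _]mulrC -cosN opprB.
- move=> p q pq; have [cp _] := cellP (cell_gen p) (cell_pos p).
  have [cq _] := cellP (cell_gen q) (cell_pos q).
  rewrite -/(rh p) in cp; rewrite -/(rh q) in cq.
  have h0 : 0 < 2^-1 ^+ cell_gen p :> R by rewrite exprn_gt0.
  have h01 : 2^-1 ^+ cell_gen p <= 1 :> R by rewrite exprn_ile1 // invf_le1 ?ler1n.
  have h0' : 0 < 2^-1 ^+ cell_gen q :> R by rewrite exprn_gt0.
  have hpq : 2^-1 ^+ cell_gen q <= 2^-1 ^+ cell_gen p :> R.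
    by apply: ler_wiXn2l => //; rewrite invf_le1 ?ler1n.
  have -> : rh p * rh q = (1 - (1 - rh p)) * (1 - (1 - rh q)) by rewrite !subKr.
  rewrite /ancestor_weight pq /weight.
  set e := absdiff _ _.
  have -> : 2 ^+ cell_gen p = (2^-1 ^+ cell_gen p)^-1 :> R by rewrite exprVn invrK.
  rewrite -[e.+1%:R]natr1; apply: pker_le => //.
  + by case/andP: cq => c1 c2; apply/andP; split; lra.
  + have /andP[? ?] := ang04 p; have /andP[? ?] := ang04 q.
    by rewrite ler_norml; apply/andP; split; lra.
  + by apply: in_cell_ancestor pq (cellP _ _) (cellP _ _).
- by move=> p; rewrite /my normrM (ger0_norm (m0 _ _)).
Qed.

(** Cosine and sine parts are two real embeddings. The dual sum of each is one of the two squares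
    bounded together in [pker_square_sum], whence the factor 2. *)
Lemma discrete_carleson_embedding N (a : nat -> R) :
  \sum_(p : cell D) mass p *
    ((\sum_(n < N) a n * (rh p ^+ n * cos (n%:R * ang p))) ^+ 2 +
     (\sum_(n < N) a n * (rh p ^+ n * sin (n%:R * ang p))) ^+ 2) <=
  2 * embedding_const K * \sum_(n < N) a n ^+ 2.
Proof.
under eq_bigr do rewrite mulrDr.
have C0 := embedding_const_gt0 K0.
have bnd (tr : R -> R) (y := fun n i =>
    \sum_(k < N) a k * (rho n i ^+ k * tr (k%:R * al n i))) :
  (forall n, (\sum_p mass p * y (cell_gen p) (cell_pos p) *
       (rh p ^+ n * tr (n%:R * ang p))) ^+ 2 <=
     (\sum_p mass p * y (cell_gen p) (cell_pos p) *
       (rh p ^+ n * cos (n%:R * ang p))) ^+ 2 +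
     (\sum_p mass p * y (cell_gen p) (cell_pos p) *
       (rh p ^+ n * sin (n%:R * ang p))) ^+ 2) ->
  \sum_p mass p * (\sum_(n < N) a n * (rh p ^+ n * tr (n%:R * ang p))) ^+ 2 <=
  embedding_const K * \sum_(n < N) a n ^+ 2.
  move=> hn; apply: (@dual_square_bound _ _ _
    (fun n p => rh p ^+ n * tr (n%:R * ang p))) => //.
  apply: le_trans (form_le y).
  apply: le_trans (pker_square_sum _ _ N rh01).
  by apply: ler_sum => n _; exact: hn.
rewrite big_split /=.
have h1 := bnd cos _; have h2 := bnd sin _.
apply: (le_trans (lerD (h1 _) (h2 _))).
- by move=> n; rewrite lerDl sqr_ge0.
- by move=> n; rewrite lerDr sqr_ge0.
- lra.
Qed.
End Embedding.
End Discrete.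

(** * Polar form of quaternions *)

Section Quat.
Variable R : realType.
Implicit Types (q p I : quat R) (t : R).

Lemma sqr_normq q : `|q| ^+ 2 = sqnormq q.
Proof. by rewrite -[`|q|]/(Num.sqrt _) sqr_sqrtr // sqnormq_ge0. Qed.

Lemma sqnormqM p q : sqnormq (p * q) = sqnormq p * sqnormq q.
Proof. by rewrite /sqnormq /=; ring. Qed.

(** The imaginary components of [I ^+ 2] are [2 * q1 I] times those of [I], so a nonzero real part
    would force [q1 I ^+ 2 = -1]. *)
Lemma imag_unitP I : imag_units I <->
  q1 I = 0 /\ qi I ^+ 2 + qj I ^+ 2 + qk I ^+ 2 = 1.
Proof.
case: I => a b c d; split=> [|/= [a0 h]]; last first.
  by rewrite a0 /imag_units /= expr2; apply: quat_ext => /=; lra.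
rewrite /imag_units /= expr2 => /(congr1 (fun q => (q1 q, qi q, qj q, qk q))) [/= h1 h2 h3 h4].
have [a0|a0] := eqVneq a 0; first by split=> //; rewrite a0 in h1; lra.
have z x : a * x + x * a = 0 -> x = 0.
  move=> h; apply/eqP; have /eqP : a * x = 0 by lra.
  by rewrite mulf_eq0 (negbTE a0).
have b0 : b = 0 by apply: z; lra.
have c0 : c = 0 by apply: z; lra.
have d0 : d = 0 by apply: z; lra.
by rewrite b0 c0 d0 in h1; have := sqr_ge0 a; lra.
Qed.

Lemma q1_expq I t : imag_units I -> q1 (expq I t) = cos t.
Proof. by move=> /imag_unitP[I0 _]; rewrite /= I0; ring. Qed.

Lemma sqnormq_expq I t : imag_units I -> sqnormq (expq I t) = 1.
Proof.
move=> /imag_unitP[I0 I1]; rewrite /sqnormq /= I0.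
transitivity (cos t ^+ 2 + sin t ^+ 2 * (qi I ^+ 2 + qj I ^+ 2 + qk I ^+ 2)); first by ring.
by rewrite I1 mulr1 cos2Dsin2.
Qed.

Lemma normq_polar I t r : imag_units I -> 0 <= r -> `|r *: expq I t| = r.
Proof.
move=> hI r0; rewrite normrZ ger0_norm // -[`|expq I t|]/(Num.sqrt _).
by rewrite sqnormq_expq // sqrtr1 mulr1.
Qed.

Lemma q1_polar I t r : imag_units I -> q1 (r *: expq I t) = r * cos t.
Proof. by move=> hI; rewrite -(q1_expq t hI). Qed.

Lemma expqD I s t : imag_units I -> expq I s * expq I t = expq I (s + t).
Proof.
rewrite /imag_units /= expr2 => hI.
rewrite /expq mulrDl !mulrDr !mulr_algl -!scalerAl -!scalerAr hI mulr1.
rewrite cosD sinD !scalerA.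
apply: quat_ext => /=; ring.
Qed.

Lemma polar_exp I t r n : imag_units I ->
  (r *: expq I t) ^+ n = r ^+ n *: expq I (n%:R * t).
Proof.
move=> hI; rewrite exprZn; congr (_ *: _).
elim: n => [|n IH].
  by rewrite expr0 mul0r /expq cos0 sin0 scale0r addr0 scale1r.
by rewrite exprS IH expqD //; congr expq; rewrite -natr1; ring.
Qed.

Lemma exists_imag_unit : exists I, imag_units I.
Proof. by exists (Quat 0 1 0 0); apply/imag_unitP => /=; split => //; ring. Qed.

Lemma abs_q1_le q : `|q1 q| <= `|q|.
Proof.
rewrite -[`|q|]/(Num.sqrt _) -sqrtr_sqr ler_wsqrtr // /sqnormq.
by rewrite -!addrA lerDl !addr_ge0 ?sqr_ge0.
Qed.

(* [cos t] determines [sin t] only up to sign, which is absorbed by [I]. *)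
Lemma polar_of_cos q t : q1 q = `|q| * cos t ->
  exists2 I, imag_units I & q = `|q| *: expq I t.
Proof.
move=> hq; have nq := sqr_normq q.
pose s := `|q| * sin t.
have hs : qi q ^+ 2 + qj q ^+ 2 + qk q ^+ 2 = s ^+ 2.
  have : `|q| ^+ 2 * (cos t ^+ 2 + sin t ^+ 2) = sqnormq q by rewrite cos2Dsin2 mulr1.
  by rewrite /sqnormq /s hq; lra.
have [s0|s0] := eqVneq s 0.
  have [J hJ] := exists_imag_unit; exists J => //.
  have Z : qi q = 0 /\ qj q = 0 /\ qk q = 0.
    move/eqP: hs; rewrite s0 expr0n /= !paddr_eq0 ?addr_ge0 ?sqr_ge0 // !sqrf_eq0.
    by move=> /andP[/andP[/eqP -> /eqP ->] /eqP ->].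
  case: Z => i0 [j0 k0]; rewrite /expq scalerDr !scalerA -/s s0 scale0r addr0.
  by apply: quat_ext => /=; rewrite ?i0 ?j0 ?k0 ?mulr0 // mulr1 hq.
pose I := Quat 0 (qi q / s) (qj q / s) (qk q / s).
exists I.
  apply/imag_unitP; split => //=; rewrite !expr_div_n -!mulrDl hs divff //.
  by rewrite expf_neq0.
rewrite /expq scalerDr !scalerA -/s.
apply: quat_ext => /=; rewrite ?mulr1 ?mulr0 ?addr0 ?add0r //.
all: by rewrite mulrC divfK.
Qed.

(* At [q = 0] the division by zero gives [argq 0 = pi / 2]. *)
Definition argq q : R := acos (q1 q / `|q|).

Lemma argq_itv q : 0 <= argq q <= pi.
Proof.
have h : -1 <= q1 q / `|q| <= 1.
  rewrite -ler_norml normrM normfV normr_id.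
  have [->|n0] := eqVneq `|q| 0; first by rewrite invr0 mulr0.
  by rewrite ler_pdivrMr ?mul1r ?abs_q1_le // lt_def n0 normr_ge0.
by rewrite acos_ge0 ?acos_lepi.
Qed.

Lemma cos_argq q : q1 q = `|q| * cos (argq q).
Proof.
have [n0|n0] := eqVneq `|q| 0.
  by rewrite n0 mul0r; apply/eqP; rewrite -normr_le0 -n0 abs_q1_le.
rewrite acosK; first by rewrite mulrC divfK.
rewrite in_itv /= -ler_norml normrM normfV normr_id.
by rewrite ler_pdivrMr ?mul1r ?abs_q1_le // lt_def n0 normr_ge0.
Qed.

Lemma polar_argq q : exists2 I, imag_units I & q = `|q| *: expq I (argq q).
Proof. exact/polar_of_cos/cos_argq. Qed.

Definition coord (l : 'I_4) q : R := nth 0 [:: q1 q; qi q; qj q; qk q] l.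

Lemma sqnormq_coord q : sqnormq q = \sum_l coord l q ^+ 2.
Proof. by rewrite !big_ord_recl big_ord0 /coord /= addr0 /sqnormq !addrA. Qed.

Lemma coord_lin l (r : nat -> R) (a : nat -> quat R) N :
  coord l (\sum_(n < N) r n *: a n) = \sum_(n < N) coord l (a n) * r n.
Proof.
apply: (big_ind2 (fun q s => coord l q = s)).
- by case: l => -[|[|[|[|]]]].
- by move=> x1 s1 x2 s2 <- <-; case: l => -[|[|[|[|]]]].
- by move=> n _; rewrite mulrC; case: l => -[|[|[|[|]]]].
Qed.

(** On the slice of [q] the sum is [c + I * s] with [|I * s| = |s|], and the parallelogram law
    bounds its square by twice the sum of squares. *)
Lemma hardy_partial_sum_le q (a : nat -> quat R) N :
  `|\sum_(n < N) q ^+ n * a n| ^+ 2 <=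
  2 * \sum_l
    ((\sum_(n < N) coord l (a n) * (`|q| ^+ n * cos (n%:R * argq q))) ^+ 2 +
     (\sum_(n < N) coord l (a n) * (`|q| ^+ n * sin (n%:R * argq q))) ^+ 2).
Proof.
have [I hI qE] := polar_argq q.
rewrite [in leLHS]qE; move: (`|q|) (argq q) => r t.
pose c := \sum_(n < N) (r ^+ n * cos (n%:R * t)) *: a n.
pose s := \sum_(n < N) (r ^+ n * sin (n%:R * t)) *: a n.
have -> : \sum_(n < N) (r *: expq I t) ^+ n * a n = c + I * s.
  rewrite /c /s mulr_sumr -big_split; apply: eq_bigr => n _ /=.
  rewrite polar_exp // /expq scalerDr !scalerA mulrDl mulr_algl -!scalerAl.
  by rewrite -scalerAr.
have cE l : \sum_(n < N) coord l (a n) * (r ^+ n * cos (n%:R * t)) = coord l c.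
  exact/esym/(coord_lin l (fun n => r ^+ n * cos (n%:R * t))).
have sE l : \sum_(n < N) coord l (a n) * (r ^+ n * sin (n%:R * t)) = coord l s.
  exact/esym/(coord_lin l (fun n => r ^+ n * sin (n%:R * t))).
under eq_bigr => l _ do rewrite cE sE.
rewrite big_split /= -!sqnormq_coord sqr_normq.
have <- : sqnormq (I * s) = sqnormq s.
  rewrite sqnormqM (_ : sqnormq I = 1) ?mul1r //.
  by have /imag_unitP[I0 I1] := hI; rewrite /sqnormq I0 expr0n /= add0r.
clear cE sE; move: c (I * s) => x y.
have := sqnormq_ge0 (x - y); rewrite /sqnormq /=; lra.
Qed.

End Quat.

(** * Measurability of boxes and sectors *)

Section Monotone.
Context d (T : measurableType d) (R : realType).
Variable mu : {measure set T -> \bar R}.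

(* Unlike in [ge0_le_integral], no measurability is required. *)
Lemma integral_mono (D : set T) (f g : T -> \bar R) :
  (forall x, D x -> 0 <= f x)%E -> (forall x, D x -> f x <= g x)%E ->
  (\int[mu]_(x in D) f x <= \int[mu]_(x in D) g x)%E.
Proof.
move=> f0 fg; have g0 x (Dx : D x) : (0 <= g x)%E := le_trans (f0 x Dx) (fg x Dx).
rewrite !ge0_integralE //; apply: le_ereal_sup => _ [h /= hf <-].
exists h => //= x; apply: le_trans (hf x) _.
by rewrite /patch; case: ifPn => // /set_mem; exact: fg.
Qed.
End Monotone.

Section Measurability.
Variable R : realType.
Implicit Types (q p : quat R).

Lemma measurable_open_quat (A : set (quat R)) : open A -> measurable A.
Proof. by move=> oA; exact: sub_sigma_algebra. Qed.

Lemma continuous_q1 : continuous (@q1 R : quat R -> R).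
Proof.
move=> p A /nbhs_normP[e e0 eA]; apply/nbhs_normP; exists e => // q pq.
by apply: eA; apply: le_lt_trans pq; exact: (abs_q1_le (p - q)).
Qed.

Lemma measurable_lt_quat (g h : quat R -> R) : continuous g -> continuous h ->
  measurable [set q | g q < h q].
Proof.
move=> cg ch; apply: measurable_open_quat.
have -> : [set q | g q < h q] = (fun q => h q - g q) @^-1` [set x | 0 < x].
  by apply/seteqP; split => q /=; rewrite subr_gt0.
apply: open_comp => [q _|]; last exact: open_gt.
exact: cvgB (ch q) (cg q).
Qed.

Lemma measurable_le_quat (g h : quat R -> R) : continuous g -> continuous h ->
  measurable [set q | g q <= h q].
Proof.
move=> cg ch; have -> : [set q | g q <= h q] = ~` [set q | h q < g q].
  by apply/seteqP; split => q /=; rewrite leNgt => /negP.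
by apply: measurableC; exact: measurable_lt_quat.
Qed.

Lemma continuous_norm_quat : continuous (fun q => `|q| : R).
Proof. exact: norm_continuous. Qed.

Lemma continuous_norm_scale (c : R) : continuous (fun q => `|q| * c : R).
Proof.
move=> q; apply: (@cvgM _ _ (nbhs q) _ (fun q : quat R => `|q|) (fun=> c)).
  exact: continuous_norm_quat.
exact: cvg_cst.
Qed.

Lemma continuous_cst_quat (c : R) : continuous (fun _ : quat R => c).
Proof. exact: cst_continuous. Qed.

(** [polar_of_cos] supplies the imaginary unit, so membership depends on the modulus and the real
    part only. *)
Lemma symmetric_boxP (r theta : R) p : symmetric_box r theta p <->
  [/\ `|p| < 1, 1 - `|p| <= 2 * (1 - r) &
      exists2 al, `|al - theta| <= 1 - r & q1 p = `|p| * cos al].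
Proof.
split=> [[p1 [rho [al [I [pE r0 hI h1 /andP[_ h3]]]]]]|[p1 h2 [al h1 hp]]].
  have np : `|p| = rho by rewrite pE normq_polar.
  split=> //; first by rewrite np.
  by exists al => //; rewrite np pE q1_polar.
have [I hI pE] := polar_of_cos hp.
split=> //; exists `|p|, al, I; split => //.
by rewrite subr_gt0 p1.
Qed.

(** Extreme and intermediate values; this replaces the quantified angle of a box by two closed
    inequalities, which are Borel. *)
Lemma image_cos_itv (a b : R) : a <= b -> exists c e,
  forall x, (exists2 al, a <= al <= b & x = cos al) <-> c <= x <= e.
Proof.
move=> ab; have cc : {within `[a, b], continuous (@cos R)}.
  by apply: continuous_subspaceT => x; exact: continuous_cos.
have [u uab hu] := EVT_min ab cc; have [v vab hv] := EVT_max ab cc.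
exists (cos u), (cos v) => x; split=> [[al alab ->]|/andP[h1 h2]].
  by rewrite hu ?hv // in_itv.
move: uab vab; rewrite !in_itv /= => /andP[u1 u2] /andP[v1 v2].
have [uv|vu] := leP u v.
  have cuv : {within `[u, v], continuous (@cos R)}.
    by apply: continuous_subspaceT => y; exact: continuous_cos.
  have xuv : Num.min (cos u) (cos v) <= x <= Num.max (cos u) (cos v).
    by rewrite ge_min le_max h1 h2 /= orbT.
  have [c] := IVT uv cuv xuv; rewrite in_itv /= => /andP[c1 c2] <-.
  by exists c => //; rewrite (le_trans u1) // (le_trans c2).
have cvu : {within `[v, u], continuous (@cos R)}.
  by apply: continuous_subspaceT => y; exact: continuous_cos.
have xvu : Num.min (cos v) (cos u) <= x <= Num.max (cos v) (cos u).
  by rewrite ge_min le_max h1 h2 /= orbT.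
have [c] := IVT (ltW vu) cvu xvu; rewrite in_itv /= => /andP[c1 c2] <-.
by exists c => //; rewrite (le_trans v1) // (le_trans c2).
Qed.

Lemma measurable_symmetric_box (r theta : R) : r <= 1 ->
  measurable (symmetric_box r theta : set (quat R)).
Proof.
move=> r1; have [|c [e ce]] := @image_cos_itv (theta - (1 - r)) (theta + (1 - r)).
  by lra.
have -> : symmetric_box r theta =
    [set p : quat R | `|p| < 1] `&` [set p | 1 - 2 * (1 - r) <= `|p|] `&`
    ([set p | `|p| * c <= q1 p] `&` [set p | q1 p <= `|p| * e]).
  apply/seteqP; split => p.
    move=> /symmetric_boxP[p1 h2 [al h1 hp]]; split; [split|] => //=; first by lra.
    have /andP[h3 h4] : c <= cos al <= e.
      apply/ce; exists al => //; move: h1; rewrite ler_norml => /andP[? ?].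
      by apply/andP; split; lra.
    by rewrite hp; split; exact: ler_wpM2l.
  move=> [[/= p1 h2] [/= h3 h4]]; apply/symmetric_boxP; split => //; first by lra.
  (* At the origin the cosine is not determined and [theta] itself serves as the angle. *)
  have [p0|p0] := eqVneq `|p| 0.
    exists theta; first by rewrite subrr normr0 subr_ge0.
    by apply/eqP; rewrite eq_le; move: h3 h4; rewrite p0 !mul0r => -> ->.
  have pp : 0 < `|p| by rewrite lt_def p0 normr_ge0.
  have : c <= q1 p / `|p| <= e by rewrite ler_pdivlMr // ler_pdivrMr // !(mulrC _ `|p|) h3.
  move=> /ce [al /andP[a1 a2] ale]; exists al.
    by rewrite ler_norml; apply/andP; split; lra.
  by rewrite -ale mulrC divfK.
have cn := continuous_norm_quat.
apply: measurableI; apply: measurableI.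
- by apply: measurable_lt_quat => //; exact: continuous_cst_quat.
- by apply: measurable_le_quat => //; exact: continuous_cst_quat.
- by apply: measurable_le_quat; [exact: continuous_norm_scale|exact: continuous_q1].
- by apply: measurable_le_quat; [exact: continuous_q1|exact: continuous_norm_scale].
Qed.

(** Cosine decreases on [[0, pi]], which turns the condition into a closed one on real part and
    modulus. The origin is set apart, since there that inequality always holds. *)
Lemma measurable_ge_argq (c : R) : measurable [set q : quat R | c <= argq q].
Proof.
have [c0|c0] := leP c 0.
  rewrite (_ : [set _ | _] = setT); first exact: measurableT.
  apply/seteqP; split => // q _ /=; apply: (le_trans c0).
  by have /andP[] := argq_itv q.
have [cpi|cpi] := ltP pi c.
  rewrite (_ : [set _ | _] = set0); first exact: measurable0.
  apply/seteqP; split => // q /= h; have /andP[_ h'] := argq_itv q.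
  by have := lt_le_trans cpi (le_trans h h'); rewrite ltxx.
have cE q : (c <= argq q) = (cos (argq q) <= cos c).
  have /andP[h h'] := argq_itv q.
  by rewrite !leNgt; congr (~~ _); rewrite ltr_cos // in_itv /= ?h ?h' ?cpi ?(ltW c0).
have mS : measurable [set q : quat R | q1 q <= `|q| * cos c].
  by apply: measurable_le_quat; [exact: continuous_q1|exact: continuous_norm_scale].
have sE q : 0 < `|q| -> (c <= argq q) = (q1 q <= `|q| * cos c).
  by move=> q0; rewrite cE cos_argq ler_pM2l.
have m0 : measurable [set q : quat R | 0 < `|q|].
  by apply: measurable_lt_quat; [exact: continuous_cst_quat|exact: continuous_norm_quat].
have mN0 := measurableC m0.
have argq0 q : ~ 0 < `|q| -> argq q = argq (0 : quat R).
  by move/negP; rewrite -leNgt normr_le0 => /eqP ->.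
have -> : [set q | c <= argq q] =
  ([set q : quat R | q1 q <= `|q| * cos c] `&` [set q : quat R | 0 < `|q|]) `|`
  (if c <= argq (0 : quat R) then ~` [set q : quat R | 0 < `|q|] else set0).
  apply/seteqP; split => q /=.
    have [q0|q0] := pselect (0 < `|q|); first by rewrite sE //; left.
    by move=> h; right; rewrite -(argq0 q q0) h.
  move=> [[h q0]|]; first by rewrite sE.
  by case: ifP => // h q0; rewrite (argq0 _ q0).
apply: measurableU; first exact: measurableI.
by case: ifP => _ //; exact: measurable0.
Qed.

(** Half-open in both variables, so that dyadic subdivision gives disjoint pieces. *)
Definition sector (lo hi a b : R) : set (quat R) :=
  [set p | lo < 1 - `|p| <= hi /\ a <= argq p < b].

Lemma measurable_sector lo hi a b : measurable (sector lo hi a b).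
Proof.
have -> : sector lo hi a b =
   ([set p : quat R | `|p| < 1 - lo] `&` [set p | 1 - hi <= `|p|]) `&`
   ([set p | a <= argq p] `\` [set p | b <= argq p]).
  apply/seteqP; split => p /=.
    move=> [/andP[h1 h2] /andP[h3 h4]].
    split; first by split; [rewrite ltrBrDl -ltrBrDr|rewrite lerBlDl -lerBlDr].
    by split => //; apply/negP; rewrite -ltNge.
  move=> [[h1 h2] [h3 /negP]]; rewrite -ltNge => h4.
  split; apply/andP; split => //.
    by rewrite ltrBrDl -ltrBrDr.
  by rewrite lerBlDl -lerBlDr.
have cn := continuous_norm_quat.
apply: measurableI; [apply: measurableI|apply: measurableD].
- by apply: measurable_lt_quat => //; exact: continuous_cst_quat.
- by apply: measurable_le_quat => //; exact: continuous_cst_quat.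
- exact: measurable_ge_argq.
- exact: measurable_ge_argq.
Qed.

End Measurability.

(** * Whitney cells *)

Section Whitney.
Variable R : realType.
Implicit Types (q p : quat R) (n i : nat).

(** A dyadic Carleson box: the union of the Whitney cells of the node and all its descendants. The
    bound 0 keeps it inside the unit ball. *)
Definition region n i : set (quat R) :=
  sector 0 (2^-1 ^+ n) (4 * i%:R * 2^-1 ^+ n) (4 * i.+1%:R * 2^-1 ^+ n).

Definition whitney n i : set (quat R) :=
  sector (2^-1 ^+ n / 2) (2^-1 ^+ n) (4 * i%:R * 2^-1 ^+ n) (4 * i.+1%:R * 2^-1 ^+ n).

Lemma region_split n i :
  region n i = whitney n i `|` (region n.+1 i.*2 `|` region n.+1 i.*2.+1).
Proof.
have h0 : 0 < 2^-1 ^+ n :> R by rewrite exprn_gt0.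
have hE : 2^-1 ^+ n.+1 = 2^-1 ^+ n / 2 :> R by rewrite exprSr.
have i1 : i.+1%:R = i%:R + 1 :> R by rewrite natr1.
have i2 : i.*2%:R = 2 * i%:R :> R by rewrite -mul2n natrM.
have i3 : i.*2.+1%:R = 2 * i%:R + 1 :> R by rewrite -natr1 i2.
have i4 : i.*2.+2%:R = 2 * i%:R + 2 :> R by rewrite -natr1 i3; ring.
rewrite /region /whitney hE i4 i3 i2 i1; set h := 2^-1 ^+ n in h0 *.
apply/seteqP; split => q; rewrite /sector /=.
  move=> [/andP[h1 h2] /andP[h3 h4]].
  have [c|c] := ltP (h / 2) (1 - `|q|); first by left; split; apply/andP.
  right; have [c'|c'] := ltP (argq q) (4 * (2 * i%:R + 1) * (h / 2)).
    by left; split; apply/andP; split => //; lra.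
  by right; split; apply/andP; split => //; lra.
by move=> [|[]] [/andP[h1 h2] /andP[h3 h4]]; split; apply/andP; split => //; lra.
Qed.

Lemma whitney_region_disjoint n i :
  whitney n i `&` (region n.+1 i.*2 `|` region n.+1 i.*2.+1) = set0.
Proof.
rewrite -subset0 => q [[/andP[h1 _] _] h2].
have {}h2 : 1 - `|q| <= 2^-1 ^+ n / 2.
  by rewrite -exprSr; case: h2 => -[/andP[_ ->]].
by move: (lt_le_trans h1 h2); rewrite ltxx.
Qed.

Lemma region_children_disjoint n i :
  region n.+1 i.*2 `&` region n.+1 i.*2.+1 = set0.
Proof.
rewrite -subset0 => q [[_ /andP[_ h1]] [_ /andP[h2 _]]].
by move: (lt_le_trans h1 h2); rewrite ltxx.
Qed.

(** With [h = 2^-n], the angular width is [4 * h] while a box at radius [1 - h] has width [2 * h];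
    two boxes side by side suffice. *)
Lemma region_sub_box n i : region n i `<=`
  symmetric_box (1 - 2^-1 ^+ n) (4 * i%:R * 2^-1 ^+ n + 2^-1 ^+ n) `|`
  symmetric_box (1 - 2^-1 ^+ n) (4 * i%:R * 2^-1 ^+ n + 3 * 2^-1 ^+ n).
Proof.
have h0 : 0 < 2^-1 ^+ n :> R by rewrite exprn_gt0.
have i1 : i.+1%:R = i%:R + 1 :> R by rewrite natr1.
rewrite /region i1; set h := 2^-1 ^+ n in h0 *.
move=> q [/andP[h1 h2] /andP[h3 h4]].
have [c|c] := leP (argq q) (4 * i%:R * h + 2 * h); [left|right];
  (apply/symmetric_boxP; split; [by rewrite -subr_gt0|lra|
    exists (argq q); last exact: cos_argq]); rewrite ler_norml; apply/andP; split; lra.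
Qed.

Section Mass.
Variables (mu : {measure set (quat R) -> \bar R}) (C : R).
Hypothesis boxC : forall (q : quat R) (r theta : R) (J : quat R),
  unit_ball q -> 0 <= r -> imag_units J -> q = r *: expq J theta ->
  (mu (symmetric_box r theta) <= (C * (1 - `|q|))%:E)%E.

Lemma measure_region_le n i : (mu (region n i) <= (2 * C / 2 ^+ n)%:E)%E.
Proof.
have h0 : 0 < 2^-1 ^+ n :> R by rewrite exprn_gt0.
have h1 : 2^-1 ^+ n <= 1 :> R by rewrite exprn_ile1 // invf_le1 ?ler1n.
rewrite -exprVn; have := @region_sub_box n i; set h := 2^-1 ^+ n in h0 h1 *.
have [J hJ] := exists_imag_unit R.
have box theta : (mu (symmetric_box (1 - h) theta) <= (C * h)%:E)%E.
  have r0 : 0 <= 1 - h by rewrite subr_ge0.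
  have nq : `|(1 - h) *: expq J theta| = 1 - h by exact: normq_polar.
  have ub : unit_ball ((1 - h) *: expq J theta) by rewrite /unit_ball /= nq; lra.
  by have := boxC ub r0 hJ erefl; rewrite nq subKr.
have mS theta : measurable (symmetric_box (1 - h) theta : set (quat R)).
  by apply: measurable_symmetric_box; rewrite gerBl ltW.
move=> sub; apply: (le_trans (le_measure _ _ _ sub)); rewrite ?inE //.
- exact: measurable_sector.
- exact: measurableU.
apply: (le_trans (measureU2 _ _ _)) => //.
have -> : (2 * C * h)%:E = ((C * h)%:E + (C * h)%:E)%E by rewrite -EFinD; congr EFin; ring.
by apply: leeD; exact: box.
Qed.

Lemma measure_region_fin n i : mu (region n i) \is a fin_num.
Proof.
rewrite ge0_fin_numE //; apply: le_lt_trans (measure_region_le n i) _; exact: ltry.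
Qed.

Lemma measure_region_split n i : mu (region n i) =
  (mu (whitney n i) + (mu (region n.+1 i.*2) + mu (region n.+1 i.*2.+1)))%E.
Proof.
have mR k l : measurable (region k l) by exact: measurable_sector.
rewrite region_split measureU //; last exact: whitney_region_disjoint.
- rewrite measureU //; exact: region_children_disjoint.
- exact: measurable_sector.
- exact: measurableU.
Qed.

Lemma measure_whitney_fin n i : mu (whitney n i) \is a fin_num.
Proof.
have := measure_region_fin n i; rewrite measure_region_split.
by rewrite fin_numD => /andP[].
Qed.

Definition whitney_mass n i : R := fine (mu (whitney n i)).

Lemma whitney_mass_ge0 n i : 0 <= whitney_mass n i.
Proof. exact: fine_ge0. Qed.

(** The packing condition: the cells of the subtree are disjoint pieces of [region n i], which two
    boxes cover. *)
Lemma tree_sum_whitney_mass d n i :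
  tree_sum d n i whitney_mass <= 2 * C / 2 ^+ n.
Proof.
suff : tree_sum d n i whitney_mass <= fine (mu (region n i)).
  move/le_trans; apply; rewrite -lee_fin fineK; first exact: measure_region_le.
  exact: measure_region_fin.
elim: d n i => [|d IH] n i; first by rewrite tree_sum0 fine_ge0.
rewrite tree_sumS measure_region_split !fineD ?fin_numD ?measure_region_fin ?measure_whitney_fin //.
by rewrite addrA lerD // lerD.
Qed.
End Mass.

End Whitney.

(** * From functions in the Hardy space to sampled points in the Whitney cells *)

Section Embedding.
Variable R : realType.
Implicit Types (q p : quat R) (n i : nat) (f : quat R -> quat R) (a : nat -> quat R).

Lemma normqM p q : `|p * q| = `|p| * `|q|.
Proof.
rewrite -[`|p * q|]/(Num.sqrt _) sqnormqM sqrtrM ?sqnormq_ge0 //.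
Qed.

Lemma normqX q n : `|q ^+ n| = `|q| ^+ n.
Proof.
elim: n => [|n IH]; last by rewrite !exprS normqM IH.
by rewrite !expr0 -[LHS]/(Num.sqrt _) /sqnormq /= expr1n !expr0n !addr0 sqrtr1.
Qed.

Lemma hardy_sqnorm_ge0 a : (0 <= hardy_sqnorm a)%E.
Proof. by apply: nneseries_ge0 => n _ _; rewrite lee_fin sqr_ge0. Qed.

Lemma hardy_partial_norm_le a (E : R) N : hardy_sqnorm a = E%:E ->
  \sum_(n < N) `|a n| ^+ 2 <= E.
Proof.
move=> aE; rewrite -lee_fin -aE -sumEFin -(big_mkord xpredT (fun n => (`|a n| ^+ 2)%:E)).
by apply: nneseries_lim_ge => n _; rewrite lee_fin sqr_ge0.
Qed.

Lemma hardy_partial_gt f a q (z : R) : hardy_expansion f a -> unit_ball q ->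
  z < `|f q| ^+ 2 ->
  \forall N \near \oo, z < `|\sum_(n < N) q ^+ n * a n| ^+ 2.
Proof.
move=> [_ fa] /fa cvf zf.
have c : (fun N => `|series (fun n => q ^+ n * a n) N| ^+ 2) @ \oo --> `|f q| ^+ 2.
  by under eq_fun do rewrite expr2; rewrite expr2; apply: cvgM; apply: cvg_norm.
near=> N.
have : z < `|series (fun n => q ^+ n * a n) N| ^+ 2 by near: N; exact: (cvgr_gt _ c).
by rewrite /series /= big_mkord.
Unshelve. all: by end_near. Qed.

(** A crude bound by a geometric series, which makes the supremum over a Whitney cell finite. *)
Lemma hardy_norm_bound f a (E : R) q : hardy_expansion f a ->
  hardy_sqnorm a = E%:E -> unit_ball q -> `|f q| ^+ 2 <= ((E + 1) / (1 - `|q|)) ^+ 2.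
Proof.
move=> fa aE hq; rewrite leNgt; apply/negP => /(hardy_partial_gt fa hq) near_gt.
have [N] := filter_ex near_gt; apply/negP; rewrite -leNgt.
have q1 : 0 < 1 - `|q| by rewrite subr_gt0.
have a1 n : `|a n| <= E + 1.
  have h : `|a n| ^+ 2 <= E.
    apply: le_trans (hardy_partial_norm_le n.+1 aE).
    by rewrite big_ord_recr /= lerDr sumr_ge0.
  by have := sqr_ge0 (`|a n| - 1); have := sqr_ge0 (`|a n|); lra.
have E0 : 0 <= E + 1 := le_trans (normr_ge0 _) (a1 0%N).
rewrite ler_pXn2r ?nnegrE ?divr_ge0 ?(ltW q1) //.
apply: (le_trans (ler_norm_sum _ _ _)).
apply: (@le_trans _ _ (\sum_(n < N) (E + 1) * `|q| ^+ n)).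
  by apply: ler_sum => n _; rewrite normqM normqX mulrC ler_wpM2r ?exprn_ge0.
rewrite -mulr_sumr ler_wpM2l // -(ler_pM2l q1) divff ?lt0r_neq0 //.
by rewrite -opprB mulNr -subrX1 opprB gerBl exprn_ge0.
Qed.

(** The bound of [hardy_partial_sum_le] without its factor 2, as a function of the polar coordinates
    alone. *)
Definition polar_energy a (N : nat) (rho al : R) : R :=
  \sum_l
    ((\sum_(n < N) coord l (a n) * (rho ^+ n * cos (n%:R * al))) ^+ 2 +
     (\sum_(n < N) coord l (a n) * (rho ^+ n * sin (n%:R * al))) ^+ 2).

(** When the supremum of [|f|^2] over the cell is positive, it is [t.1], and [t.2] is a point where
    more than half of it is attained. The factor 4 combines this half with the 2 of
    [hardy_partial_sum_le]. *)
Lemma whitney_sup f a n i : hardy_expansion f a ->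
  exists t : R * (R * R), [/\ 0 <= t.1, in_cell n i t.2.1 t.2.2,
    (forall q, whitney n i q -> `|f q| ^+ 2 <= t.1) &
    \forall N \near \oo, t.1 <= 4 * polar_energy a N t.2.1 t.2.2].
Proof.
move=> fa; have h0 : 0 < 2^-1 ^+ n :> R by rewrite exprn_gt0.
have pe0 N r t : 0 <= 4 * polar_energy a N r t.
  by rewrite mulr_ge0 // sumr_ge0 // => l _; rewrite addr_ge0 // sqr_ge0.
have cell0 : in_cell n i (1 - 2^-1 ^+ n) (4 * i%:R * 2^-1 ^+ n : R).
  by rewrite /in_cell -[i.+1%:R]natr1; split; apply/andP; split; lra.
pose V := [set `|f q| ^+ 2 | q in whitney n i].
(* Cells beyond the angle [pi] are empty; the value 0 at a corner point then serves. *)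
have [->|/set0P V0] := eqVneq (whitney n i : set (quat R)) set0.
  exists (0, (1 - 2^-1 ^+ n, 4 * i%:R * 2^-1 ^+ n)); split => //=.
  by apply: nearW => N; exact: pe0.
have afin : hardy_sqnorm a \is a fin_num by rewrite ge0_fin_numE ?hardy_sqnorm_ge0; case: fa.
have aE : hardy_sqnorm a = (fine (hardy_sqnorm a))%:E by rewrite fineK.
set E := fine _ in aE.
have wball q : whitney n i q -> unit_ball q.
  by move=> [/andP[h1 _] _]; rewrite /unit_ball /=; lra.
have supV : has_sup V.
  split; first by case: V0 => q hq; exists (`|f q| ^+ 2), q.
  exists (((E + 1) / (2^-1 ^+ n / 2)) ^+ 2) => _ [q hq <-].
  apply: (le_trans (hardy_norm_bound fa aE (wball _ hq))).
  have [/andP[h1 _] _] := hq.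
  have E0 : 0 <= E by rewrite fine_ge0 // hardy_sqnorm_ge0.
  have d0 : 0 < 2^-1 ^+ n / 2 :> R by rewrite divr_gt0.
  have d1 : 0 < 1 - `|q| := lt_trans d0 h1.
  have E1 : 0 <= E + 1 by rewrite addr_ge0.
  rewrite ler_pXn2r ?nnegrE ?divr_ge0 ?(ltW d0) ?(ltW d1) //.
  by rewrite ler_wpM2l // lef_pV2 ?posrE // ltW.
have ubV q : whitney n i q -> `|f q| ^+ 2 <= sup V.
  by move=> hq; apply: sup_ubound; [exact: supV.2|exists q].
have [s0|s0] := leP (sup V) 0.
  exists (0, (1 - 2^-1 ^+ n, 4 * i%:R * 2^-1 ^+ n)); split => //=.
    by move=> q /ubV/le_trans; apply.
  by apply: nearW => N; exact: pe0.
have s2 : 0 < sup V / 2 by rewrite divr_gt0.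
have [_ [q hq <-] hs] := sup_adherent s2 supV.
exists (sup V, (`|q|, argq q)); split => //=; first exact: ltW.
  have [/andP[c1 c2] /andP[c3 c4]] := hq.
  by split; apply/andP; split; rewrite // ltW.
have h : sup V / 2 < `|f q| ^+ 2 by lra.
near=> N.
have hN : sup V / 2 < `|\sum_(n < N) q ^+ n * a n| ^+ 2.
  by near: N; exact: (hardy_partial_gt fa (wball _ hq) h).
have := le_trans (ltW hN) (hardy_partial_sum_le q a N).
by rewrite -/(polar_energy a N `|q| (argq q)); lra.
Unshelve. all: by end_near. Qed.

End Embedding.

(** * From the box condition to the Carleson inequality *)

Section BoxImpliesCarleson.
Variable R : realType.
Implicit Types (q p : quat R) (n i : nat) (f : quat R -> quat R) (a : nat -> quat R).

Lemma exists_dyadic_scale (de : R) : 0 < de <= 1 ->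
  exists n, 2^-1 ^+ n / 2 < de <= 2^-1 ^+ n.
Proof.
move=> /andP[d0 d1].
have ex : exists n, (2^-1 ^+ n / 2 < de).
  have c : (GRing.exp (2^-1 : R)) @ \oo --> (0 : R).
    by apply: cvg_expr; rewrite ger0_norm // invf_lt1 // ltr1n.
  have [n hn] := filter_ex (cvgr_lt _ c _ d0); exists n.
  apply: le_lt_trans hn; have : 0 <= 2^-1 ^+ n :> R by rewrite exprn_ge0.
  by lra.
exists (ex_minn ex); case: ex_minnP => n -> nmin /=.
case: n nmin => [|n] nmin; first by rewrite expr0.
rewrite leNgt; apply/negP => h.
have : (n < n)%N by apply: nmin; rewrite -exprSr.
by rewrite ltnn.
Qed.

Lemma whitney_cover q : unit_ball q ->
  exists n i, (i < 2 ^ n)%N /\ whitney n i q.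
Proof.
rewrite /unit_ball /= => hq.
have [|n hn] := @exists_dyadic_scale (1 - `|q|).
  by have := normr_ge0 q; move=> ?; apply/andP; split; lra.
have h0 : 0 < 2^-1 ^+ n :> R by rewrite exprn_gt0.
have /andP[t0 tpi] := argq_itv q.
have t4 : argq q < 4 by apply: (le_lt_trans tpi); have := pihalf_lt2 R; lra.
have pn : (0 < 2 ^ n)%N by rewrite expn_gt0.
(* The last cell of generation [n] ends at 4, beyond [pi], so the least admissible [i] is below
   [2 ^ n]. *)
have last_cell : argq q < 4 * ((2 ^ n).-1).+1%:R * 2^-1 ^+ n.
  by rewrite prednK // natrX -mulrA -exprMn mulfV ?pnatr_eq0 // expr1n mulr1.
have ex : exists i, argq q < 4 * i.+1%:R * 2^-1 ^+ n by exists (2 ^ n).-1.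
exists n, (ex_minn ex); case: ex_minnP => i hi imin; split.
  by rewrite -[X in (_ < X)%N](prednK pn) ltnS imin.
split=> //; rewrite hi andbT.
case: i hi imin => [|i] hi imin; first by rewrite mulr0 mul0r.
rewrite leNgt; apply/negP => /imin; by rewrite ltnn.
Qed.

Variables (mu : {measure set (quat R) -> \bar R}) (C : R).
Hypothesis C0 : 0 < C.
Hypothesis boxC : forall (q : quat R) (r theta : R) (J : quat R),
  unit_ball q -> 0 <= r -> imag_units J -> q = r *: expq J theta ->
  (mu (symmetric_box r theta) <= (C * (1 - `|q|))%:E)%E.

(** The scalar embedding with packing constant [2 * C], summed over the four real components. *)
Lemma energy_sum_le D N a (rho al : nat -> nat -> R) :
  (forall n i, in_cell n i (rho n i) (al n i)) ->
  \sum_(p : cell D) whitney_mass mu (cell_gen p) (cell_pos p) *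
    polar_energy a N (rho (cell_gen p) (cell_pos p)) (al (cell_gen p) (cell_pos p)) <=
  2 * embedding_const (2 * C) * \sum_(n < N) `|a n| ^+ 2.
Proof.
move=> cellP; have K0 : 0 < 2 * C by rewrite mulr_gt0.
have E l := discrete_carleson_embedding D K0 (whitney_mass_ge0 mu)
  (tree_sum_whitney_mass boxC) cellP N (fun n => coord l (a n)).
under [leLHS]eq_bigr => p _ do rewrite /polar_energy mulr_sumr.
rewrite exchange_big /=; apply: (le_trans (ler_sum _ (fun l _ => E l))).
rewrite -mulr_sumr exchange_big /=.
by under [in leLHS]eq_bigr => n _ do rewrite -sqnormq_coord -sqr_normq.
Qed.

Lemma whitney_sum_le a (E : R) (t : nat -> nat -> R * (R * R)) D :
  hardy_sqnorm a = E%:E ->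
  (forall n i, in_cell n i (t n i).2.1 (t n i).2.2) ->
  (forall n i, \forall N \near \oo,
     (t n i).1 <= 4 * polar_energy a N (t n i).2.1 (t n i).2.2) ->
  \sum_(n < D) \sum_(i < 2 ^ n) (t n i).1 * whitney_mass mu n i <=
  8 * embedding_const (2 * C) * E.
Proof.
move=> aE tcell tnear.
have K0 : 0 < 2 * C by rewrite mulr_gt0.
(* Only finitely many cells occur below generation [D], so one truncation [N] serves them all. *)
have [N hN] : exists N, forall p : cell D, (t (cell_gen p) (cell_pos p)).1 <=
   4 * polar_energy a N (t (cell_gen p) (cell_pos p)).2.1 (t (cell_gen p) (cell_pos p)).2.2.
  near \oo => N; exists N; near: N; apply: filter_forall => p; exact: tnear.
rewrite -(sum_cell D (fun n i => (t n i).1 * whitney_mass mu n i)).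
apply: (@le_trans _ _ (4 * (2 * embedding_const (2 * C) * \sum_(n < N) `|a n| ^+ 2))).
  have := energy_sum_le D N a tcell.
  move/(ler_wpM2l (ler0n R 4)); apply: le_trans.
  rewrite mulr_sumr; apply: ler_sum => p _.
  have := ler_wpM2l (whitney_mass_ge0 mu (cell_gen p) (cell_pos p)) (hN p); lra.
have e0 := embedding_const_gt0 K0.
have := ler_wpM2l (ltW e0) (hardy_partial_norm_le N aE); lra.
Unshelve. all: by end_near. Qed.

(** [|f|^2] is dominated by a step function constant on each Whitney cell, integrated generation by
    generation; [whitney_sum_le] bounds the partial sums uniformly in [D]. *)
Lemma carleson_of_box : carleson_measure mu.
Proof.
exists (8 * embedding_const (2 * C)) => f a fa.
have afin : hardy_sqnorm a \is a fin_num by rewrite ge0_fin_numE ?hardy_sqnorm_ge0; case: fa.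
have aE : hardy_sqnorm a = (fine (hardy_sqnorm a))%:E by rewrite fineK.
pose t n i := projT1 (cid (whitney_sup n i fa)).
have tP n i : _ := projT2 (cid (whitney_sup n i fa)).
pose G n q : \bar R := (\sum_(i < 2 ^ n) ((t n i).1%:E * (\1_(whitney n i) q)%:E))%E.
have t0 n i : 0 <= (t n i).1 by case: (tP n i).
have mW n i : measurable (whitney n i : set (quat R)) by exact: measurable_sector.
have mB : measurable (@unit_ball R).
  apply: measurable_lt_quat; [exact: continuous_norm_quat|exact: continuous_cst_quat].
have term0 n i q : (0 <= (t n i).1%:E * (\1_(whitney n i) q)%:E :> \bar R)%E.
  by rewrite mule_ge0 ?lee_fin.
have G0 n q : (0 <= G n q)%E by apply: sume_ge0.
pose h n i : quat R -> \bar R := fun q => ((t n i).1%:E * (\1_(whitney n i) q)%:E)%E.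
have mT n i : measurable_fun (@unit_ball R) (h n i).
  apply: (measurable_funeM (t n i).1%:E); apply/measurable_EFinP.
  exact: measurable_indic.
have mG n : measurable_fun (@unit_ball R) (G n) by apply: emeasurable_sum => i; exact: mT.
have fG q : unit_ball q -> ((`|f q| ^+ 2)%:E <= \sum_(0 <= n <oo) G n q)%E.
  move=> hq; have [n [i [i2 hW]]] := whitney_cover hq.
  apply: le_trans (nneseries_lim_ge n.+1 (fun k _ _ => G0 k q)).
  rewrite big_nat_recr //=; apply: (@le_trans _ _ (G n q)); last first.
    by apply: leeDr; apply: sume_ge0 => k _; exact: G0.
  rewrite /G (bigD1 (Ordinal i2)) //=.
  apply: (@le_trans _ _ ((t n i).1%:E * (\1_(whitney n i) q)%:E)%E); last first.
    by apply: leeDl; apply: sume_ge0 => k _; exact: term0.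
  rewrite indicE mem_set // mule1 lee_fin.
  by case: (tP n i) => _ _ /(_ _ hW).
(* The majorant is measurable; [integral_mono] makes the comparison without measurability of
   [|f|^2]. *)
apply: (le_trans (integral_mono mu (g := fun q => \sum_(0 <= n <oo) G n q)%E _ fG)).
  by move=> q _; rewrite lee_fin sqr_ge0.
rewrite integral_nneseries //.
have IG n : (\int[mu]_(q in @unit_ball R) G n q <=
    (\sum_(i < 2 ^ n) (t n i).1 * whitney_mass mu n i)%:E)%E.
  rewrite (ge0_integral_sum mu mB (f := fun (i : 'I_(2 ^ n)) q => h n i q)); first last.
  - by move=> i q' _; exact: term0.
  - by move=> i; exact: mT.
  rewrite -sumEFin; apply: lee_sum => i _.
  rewrite ge0_integralZl_EFin //; last exact/measurable_EFinP/measurable_indic.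
  rewrite integral_indic // EFinM; apply: lee_wpmul2l; first by rewrite lee_fin.
  rewrite fineK; last exact: measure_whitney_fin boxC n i.
  apply: le_measure; rewrite ?inE; [exact: measurableI|exact: mW|exact: subIsetl].
apply: lime_le; first by apply: is_cvg_nneseries => n _ _; exact: integral_ge0.
apply: nearW => D; rewrite aE -EFinM.
apply: (le_trans (lee_sum _ (fun n _ => IG n))).
rewrite big_mkord sumEFin lee_fin.
by apply: whitney_sum_le aE _ _ => n i; case: (tP n i).
Qed.

End BoxImpliesCarleson.

(** * Test functions *)

Section CarlesonImpliesBox.
Variable R : realType.
Implicit Types (q p : quat R) (n i : nat) (r theta al : R).

(** The numerator is at least [1 - r], and [pden] is at most [(3 * (1 - r)) ^+ 2 + (1 - r) ^+ 2]. *)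
Lemma pker_ge_inv r t de : 0 <= r < 1 -> 0 <= t <= r -> 1 - t <= 3 * (1 - r) ->
  `|de| <= 1 - r -> (10 * (1 - r))^-1 <= pker t de.
Proof.
move=> /andP[r0 r1] /andP[t0 tr] t3 hde.
have d0 : 0 < 1 - r by lra.
have t01 : 0 <= t < 1 by rewrite t0; lra.
have p0 := pden_gt0 de t01.
rewrite /pker ler_pdivlMr // mulrC ler_pdivrMr ?mulr_gt0 //.
have num : 1 - r <= 1 - t * cos de by have := ler_wpM2l t0 (cos_le1 de); lra.
have cde : 1 - de ^+ 2 / 2 <= cos de.
  have := cos_ge_quadratic (normr_ge0 de); rewrite real_normK ?num_real //.
  by case: (ger0P de) => _ //; rewrite cosN.
have de2 : de ^+ 2 <= (1 - r) ^+ 2.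
  by rewrite -real_normK ?num_real // ler_pXn2r ?nnegrE // ltW.
have t2 : (1 - t) ^+ 2 <= (3 * (1 - r)) ^+ 2.
  by rewrite ler_pXn2r ?nnegrE //; lra.
have c2 : 2 * t * (1 - cos de) <= 2 * (1 - cos de).
  have c0 : 0 <= 1 - cos de by rewrite subr_ge0 cos_le1.
  by rewrite ler_wpM2r // ler_piMr //; lra.
rewrite pdenE.
have := ler_wpM2r (ltW d0) num; lra.
Qed.

(* The coefficients of [k_w + k_(\bar w)] for the Szego kernel [k_w] at
   [w = r e^(i theta)]; being real, they give a function whose modulus is large
   near both [w] and its conjugate, on every slice. *)
Definition test_coef r theta n : quat R := (2 * (r ^+ n * cos (n%:R * theta)))%:A.

Definition test_fun r theta q : quat R :=
  lim (series (fun n => q ^+ n * test_coef r theta n) @ \oo).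

(** As the coefficients are real, the series splits into a real part and a multiple of [I];
    product-to-sum formulas turn both into sums at the angles [al - theta] and [al + theta]. *)
Lemma test_fun_cvg r theta q al : 0 <= r < 1 -> unit_ball q ->
  q1 q = `|q| * cos al ->
  series (fun n => q ^+ n * test_coef r theta n) @ \oo --> test_fun r theta q /\
  q1 (test_fun r theta q) =
    pker (`|q| * r) (al - theta) + pker (`|q| * r) (al + theta).
Proof.
move=> /andP[r0 r1] q1' hal; set t := `|q| * r.
have t01 : 0 <= t < 1 by rewrite mulr_ge0 //= mulr_ilt1.
have [I hI qE] := polar_of_cos hal.
pose S de be N := \sum_(n < N) t ^+ n * cos (n%:R * de + be).
pose L de be := (cos be - t * cos (be - de)) / pden t de.
(* This phase turns cosines into sines, so [geometric_cos_cvg] also covers the multiple of [I]. *)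
pose hpi : R := - (pi / 2).
pose c N := S (al - theta) 0 N + S (al + theta) 0 N.
pose s N := S (al - theta) hpi N + S (al + theta) hpi N.
have seriesE : series (fun n => q ^+ n * test_coef r theta n) =
    (fun N => (c N)%:A + s N *: I).
  apply/funext => N; rewrite /series /= big_mkord /c /s /S -!big_split /= !scaler_suml.
  rewrite -big_split; apply: eq_bigr => n _ /=.
  rewrite -!mulrDr /test_coef mulr_algr [in LHS]qE polar_exp // /expq.
  rewrite !scalerDr !scalerA /hpi !cosBpihalf !addr0 /t exprMn.
  rewrite (mulrBr n%:R al) (mulrDr n%:R al) cosB cosD sinB sinD.
  by congr (_ *: _ + _ *: _); ring.
have cS de be : S de be @ \oo --> L de be by exact: geometric_cos_cvg.
pose l : quat R := (L (al - theta) 0 + L (al + theta) 0)%:A +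
   (L (al - theta) hpi + L (al + theta) hpi) *: I.
have cl : series (fun n => q ^+ n * test_coef r theta n) @ \oo --> l.
  rewrite seriesE; apply: cvgD; apply: cvgZl; exact: cvgD.
have fl : test_fun r theta q = l by apply: cvg_lim => //; exact: norm_hausdorff.
rewrite fl; split => //.
have [I0 _] := (imag_unitP I).1 hI.
rewrite /l /= I0 mulr0 addr0 mulr1 /L /pker cos0 !sub0r !cosN.
by [].
Qed.

Lemma test_coef_sqnorm_le r theta : 0 <= r < 1 ->
  (hardy_sqnorm (test_coef r theta) <= (4 / (1 - r))%:E)%E.
Proof.
move=> /andP[r0 r1]; have d0 : 0 < 1 - r by lra.
apply: lime_le; first by apply: is_cvg_nneseries => n _ _; rewrite lee_fin sqr_ge0.
apply: nearW => N; rewrite sumEFin lee_fin big_mkord.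
apply: (@le_trans _ _ (\sum_(n < N) 4 * r ^+ n)).
  apply: ler_sum => n _; rewrite sqr_normq /sqnormq /= !mulr0 !expr0n /= !addr0 mulr1.
  set x := cos _; rewrite !exprMn.
  have -> : 2 ^+ 2 = 4 :> R by rewrite -natrX.
  rewrite ler_wpM2l // -[leRHS]mulr1; apply: ler_pM; rewrite ?sqr_ge0 //.
    by rewrite expr2 ler_piMr ?exprn_ge0 // exprn_ile1 // ltW.
  rewrite -(real_normK (num_real x)) exprn_ile1 //; exact: cos_max.
rewrite -mulr_sumr ler_wpM2l // -(ler_pM2l d0) divff ?lt0r_neq0 //.
by rewrite -opprB mulNr -subrX1 opprB gerBl exprn_ge0.
Qed.

Lemma test_fun_box r theta q : 0 <= r < 1 -> symmetric_box r theta q ->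
  ((10 * (1 - r))^-1) ^+ 2 <= `|test_fun r theta q| ^+ 2.
Proof.
move=> r01 /symmetric_boxP[hq h2 [al hal qal]]; have /andP[r0 r1] := r01.
have [_ f1] := test_fun_cvg theta r01 hq qal.
have t01 : 0 <= `|q| * r < 1 by rewrite mulr_ge0 //= mulr_ilt1.
have q0 := normr_ge0 q.
have k1 : (10 * (1 - r))^-1 <= pker (`|q| * r) (al - theta).
  apply: pker_ge_inv => //.
    by rewrite mulr_ge0 //= ler_piMl // ltW.
  (* Uses [1 - |q| * r = (1 - r) + r * (1 - |q|)] with [1 - |q| <= 2 * (1 - r)] on the box. *)
  have := mulr_ge0 r0 (_ : 0 <= 2 * (1 - r) - (1 - `|q|)).
  rewrite subr_ge0 => /(_ h2); have := mulr_ge0 r0 (_ : 0 <= 1 - r).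
  rewrite subr_ge0 => /(_ (ltW r1)); nra.
have k2 := pker_ge0 (al + theta) t01.
have d0 : 0 <= (10 * (1 - r))^-1 by rewrite invr_ge0 mulr_ge0 // subr_ge0 ltW.
rewrite ler_pXn2r ?nnegrE //.
by apply: le_trans (abs_q1_le _); apply: le_trans (ler_norm _); rewrite f1; lra.
Qed.

Lemma box_of_carleson (mu : {measure set (quat R) -> \bar R}) :
  carleson_measure mu ->
  exists C : R, 0 < C /\
    forall (q : quat R) (r theta : R) (J : quat R),
      unit_ball q -> 0 <= r -> imag_units J -> q = r *: expq J theta ->
      (mu (symmetric_box r theta) <= (C * (1 - `|q|))%:E)%E.
Proof.
(* The lower bound [1 / (100 * (1 - r) ^+ 2)] on the box against the norm bound [4 / (1 - r)] gives
   400; [|c|] and the added 1 make the constant positive. *)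
move=> [c hc]; exists (400 * `|c| + 1); split.
  apply: ltr_wpDl; last exact: ltr01.
  by apply: mulr_ge0; [exact: ler0n|exact: normr_ge0].
move=> q r theta J hq r0 hJ qE; have qr : `|q| = r by rewrite qE normq_polar.
have r1 : r < 1 by rewrite -qr.
have r01 : 0 <= r < 1 by rewrite r0.
have d0 : 0 < 1 - r by rewrite subr_gt0.
have exp_f : hardy_expansion (test_fun r theta) (test_coef r theta).
  split; first by apply: le_lt_trans (test_coef_sqnorm_le theta r01) _; exact: ltry.
  by move=> p hp; have [] := test_fun_cvg theta r01 hp (cos_argq p).
pose k : R := ((10 * (1 - r))^-1) ^+ 2.
have k0 : 0 < k by rewrite exprn_gt0 // invr_gt0 mulr_gt0.
have mS : measurable (symmetric_box r theta : set (quat R)).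
  by apply: measurable_symmetric_box; exact: ltW.
have mB : measurable (@unit_ball R).
  apply: measurable_lt_quat; [exact: continuous_norm_quat|exact: continuous_cst_quat].
have low : (k%:E * mu (symmetric_box r theta) <= (`|c| * (4 / (1 - r)))%:E)%E.
  apply: (@le_trans _ _ (\int[mu]_(p in @unit_ball R)
      (k%:E * (\1_(symmetric_box r theta) p)%:E))%E).
    rewrite ge0_integralZl_EFin ?(ltW k0) //; last exact/measurable_EFinP/measurable_indic.
    by rewrite integral_indic // setIidl // => p [].
  apply: (@le_trans _ _ (\int[mu]_(p in @unit_ball R)
      (`|test_fun r theta p| ^+ 2)%:E)%E).
    apply: integral_mono => p hp; first by rewrite mule_ge0 ?lee_fin ?(ltW k0).
    rewrite indicE; have [pS|pS] := boolP (p \in symmetric_box r theta); last first.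
      by rewrite mule0 lee_fin sqr_ge0.
    by rewrite mule1 lee_fin; apply: test_fun_box => //; exact: set_mem.
  apply: (le_trans (hc _ _ exp_f)).
  apply: (@le_trans _ _ (`|c|%:E * hardy_sqnorm (test_coef r theta))%E).
    by apply: lee_wpmul2r; [exact: hardy_sqnorm_ge0|rewrite lee_fin ler_norm].
  by rewrite EFinM; apply: lee_wpmul2l; [rewrite lee_fin|exact: test_coef_sqnorm_le].
have -> : mu (symmetric_box r theta) = (k^-1%:E * (k%:E * mu (symmetric_box r theta)))%E.
  by rewrite muleA -EFinM mulVf ?lt0r_neq0 // mul1e.
apply: (@le_trans _ _ (k^-1%:E * (`|c| * (4 / (1 - r)))%:E)%E).
  by apply: lee_wpmul2l => //; rewrite lee_fin invr_ge0 ltW.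
rewrite -EFinM lee_fin qr.
have -> : k^-1 * (`|c| * (4 / (1 - r))) = 400 * `|c| * (1 - r).
  by rewrite /k exprVn invrK; field; rewrite lt0r_neq0.
by rewrite ler_wpM2r ?(ltW d0) // lerDl.
Qed.
End CarlesonImpliesBox.

Theorem theorem1p2 (R : realType) (mu : {measure set (quat R) -> \bar R}) :
  carleson_measure mu <->
  exists C : R, 0 < C /\
    forall (q : quat R) (r theta : R) (J : quat R),
      unit_ball q -> 0 <= r -> imag_units J -> q = r *: expq J theta ->
      (mu (symmetric_box r theta) <= (C * (1 - `|q|))%:E)%E.
Proof.
split; first exact: box_of_carleson.
by move=> [C [C0 boxC]]; exact: carleson_of_box C0 boxC.
Qed.
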